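(* Let $n,k,l$ be positive integers with $l\le k$. Suppose Bob holds a set $Y$ of $k$ binary strings of length $n$, and Alice holds $l$ strings, each of which belongs to $Y$; Bob must learn all $l$ of Alice's strings. For this problem there exists a communication protocol with communication complexity $$C \le 2\log n + (2l+4)\log k + O(l).$$ The protocol is probabilistic: Bob's algorithm uses random bits. The answer obtained by the protocol is always correct (the error probability is zero), and the number of bits sent does not depend on the outcomes of the random bits. The expected running time of Bob (averaged over the random bits) is $O(k^3n^3)$. Alice uses a deterministic algorithm running in time $O(l n^2)$.
   Context: $\log$ is the binary logarithm. Alice and Bob agree on a protocol in advance (knowing $n,k,l$ but not the inputs), then exchange bits in both directions according to it; at the end Bob (not necessarily Alice) must output the required answer. The communication complexity of a protocol is the total number of bits sent in both directions in the worst case. In a probabilistic protocol each participant may additionally use his or her own private random string; the error probability is the probability over these random strings, for the worst-case admissible input, that Bob's output is wrong. The constants in $O(\cdot)$ are absolute. *)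

(* Defs.v *)
From HB Require Import structures.
From mathcomp Require Import all_boot all_order all_algebra.
From mathcomp Require Import all_classical all_reals all_analysis.
Set Implicit Arguments.
Unset Strict Implicit.
Unset Printing Implicit Defensive.
Import Order.TTheory GRing.Theory Num.Theory.
Local Open Scope nat_scope.

(* Algorithms are programs of a random access machine with registers
   (addressed by constants) and arrays (addressed indirectly), all initially 0
   except for the input.  Time is counted at the logarithmic (bit) cost: every
   value read, written or used as an address is charged its binary length, and
   multiplication and division are charged as in the schoolbook algorithms. *)

Definition bitlen (v : nat) : nat := (trunc_log 2 v).+1.

Inductive binop := Add | Sub | Mul | Div | Mod | Eq | Lt.

Definition op_val (o : binop) (u v : nat) : nat :=
  match o with
  | Add => u + v
  | Sub => u - v
  | Mul => u * v
  | Div => u %/ v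
  | Mod => u %% v
  | Eq => u == v
  | Lt => u < v
  end.

Definition op_cost (o : binop) (u v : nat) : nat :=
  match o with
  | Mul | Div | Mod => bitlen u * bitlen v
  | Add | Sub | Eq | Lt => bitlen u + bitlen v
  end.

Inductive expr :=
  | Cst of nat
  | Reg of nat
  | Get of nat & expr            (* Get a i : cell i of array a *)
  | Bin of binop & expr & expr.

Record store := Store { reg : nat -> nat ; arr : nat -> nat -> nat }.

Fixpoint eval (s : store) (e : expr) : nat :=
  match e with
  | Cst v => v
  | Reg x => reg s x
  | Get a i => arr s a (eval s i)
  | Bin o e1 e2 => op_val o (eval s e1) (eval s e2)
  end.

Fixpoint ecost (s : store) (e : expr) : nat :=
  match e with
  | Cst _ | Reg _ => bitlen (eval s e)
  | Get _ i => ecost s i + bitlen (eval s i) + bitlen (eval s e)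
  | Bin o e1 e2 => ecost s e1 + ecost s e2 + op_cost o (eval s e1) (eval s e2)
  end.

Definition set_reg (s : store) (x v : nat) : store :=
  Store (fun y => if y == x then v else reg s y) (arr s).

Definition set_arr (s : store) (a i v : nat) : store :=
  Store (reg s)
    (fun b j => if (b == a) && (j == i) then v else arr s b j).

Inductive com :=
  | Skip
  | Assign of nat & expr
  | Put of nat & expr & expr     (* Put a i e : cell i of array a := e *)
  | Seq of com & com
  | If of expr & com & com       (* a condition holds when it is nonzero *)
  | While of expr & com
  | Flip of nat                  (* register := fresh private random bit *)
  | Send of expr                 (* send one bit: is the value nonzero? *)
  | Recv of nat.                 (* register := next bit received *)

Fixpoint flip_free (c : com) : bool :=
  match c with
  | Flip _ => false
  | Seq c1 c2 | If _ c1 c2 => flip_free c1 && flip_free c2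
  | While _ c1 => flip_free c1
  | _ => true
  end.

(* The state of one participant.  [control] is the list of commands still to be
   executed; it always consists of subprograms of the original program. *)
Record party := Party {
  control : seq com ;
  memory : store ;
  inbox : seq bool ;             (* bits received but not yet read *)
  flips : nat ;                  (* number of random bits used so far *)
  sent : nat ;                   (* number of bits sent so far *)
  time : nat                     (* cost of all the commands executed so far *)
}.

Definition halted (p : party) : bool := nilp (control p).

(* One step of a participant whose private random string is [coin], with the
   bits sent during that step.  A participant which has halted, or which waits
   for a bit that has not arrived, is idle, and idling costs no time. *)
Definition step (coin : nat -> bool) (p : party) : party * seq bool :=
  let: Party ctl s ib f m t := p in
  match ctl with
  | [::] => (p, [::])
  | Skip :: k => (Party k s ib f m t.+1, [::])
  | Assign x e :: k =>
      let v := eval s e in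
      (Party k (set_reg s x v) ib f m (t + (ecost s e + bitlen v).+1), [::])
  | Put a i e :: k =>
      let j := eval s i in let v := eval s e in
      (Party k (set_arr s a j v) ib f m
         (t + (ecost s i + ecost s e + bitlen j + bitlen v).+1), [::])
  | Seq c1 c2 :: k => (Party (c1 :: c2 :: k) s ib f m t.+1, [::])
  | If e c1 c2 :: k =>
      (Party ((if eval s e != 0 then c1 else c2) :: k) s ib f m
         (t + (ecost s e).+1), [::])
  | While e c1 :: k =>
      (Party (if eval s e != 0 then c1 :: ctl else k) s ib f m
         (t + (ecost s e).+1), [::])
  | Flip x :: k => (Party k (set_reg s x (coin f)) ib f.+1 m t.+1, [::])
  | Send e :: k =>
      (Party k s ib f m.+1 (t + (ecost s e).+1), [:: eval s e != 0])
  | Recv x :: k =>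
      if ib is b :: ib' then (Party k (set_reg s x b) ib' f m t.+1, [::])
      else (p, [::])
  end.

Definition deliver (p : party) (msg : seq bool) : party :=
  Party (control p) (memory p) (inbox p ++ msg) (flips p) (sent p) (time p).

(* The participants interact only through blocking reads on first-in first-out
   channels, so running them in lockstep is no loss of generality: neither can
   observe their relative speed. *)
Definition joint_step (coinA coinB : nat -> bool) (AB : party * party) :
    party * party :=
  let: (A, msgA) := step coinA AB.1 in
  let: (B, msgB) := step coinB AB.2 in
  (deliver A msgB, deliver B msgA).

(* Registers 0, 1, 2 hold n, k, l; the cell i * n + j of array 0 holds the bit
   number j of the string number i. *)
Definition start (c : com) (n k l : nat) (input : seq bool) : party :=
  Party [:: c]
    (Store (nth 0 [:: n; k; l])
           (fun a i => if a == 0 then nat_of_bool (nth false input i) else 0))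
    [::] 0 0 0.

Definition bits_of (m n : nat) (x : m.-tuple (n.-tuple bool)) : seq bool :=
  flatten (map val x).

(* The answer is written in array 1, in the same layout as the input. *)
Definition answer (n l : nat) (p : party) : l.-tuple (n.-tuple bool) :=
  [tuple [tuple arr (memory p) 1 (i * n + j) != 0 | j < n] | i < l].

Section Protocol.
Variables (alice bob : com) (n k l : nat).
Variables (X : l.-tuple (n.-tuple bool)) (Y : k.-tuple (n.-tuple bool)).

(* The states of Alice and Bob after t steps, on Alice's input X and Bob's
   input Y, when Bob's random string is [coin].  It is only used when Alice's
   program is [flip_free], so that her own random string is irrelevant. *)
Definition run (coin : nat -> bool) (t : nat) : party * party :=
  iter t (joint_step (fun=> false) coin)
    (start alice n k l (bits_of X), start bob n k l (bits_of Y)).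

Definition bits_sent (coin : nat -> bool) (t : nat) : nat :=
  sent (run coin t).1 + sent (run coin t).2.

Definition all_halted (coin : nat -> bool) (t : nat) : bool :=
  halted (run coin t).1 && halted (run coin t).2.

(* Total running time of Bob; it is +oo when he computes forever. *)
Definition bob_time (R : realType) (coin : nat -> bool) : \bar R :=
  ereal_sup (range (fun t : nat => ((time (run coin t).2)%:R)%:E)).

End Protocol.

Local Open Scope ring_scope.

(* The random variables coin 0, coin 1, ... are independent uniform bits:
   every finite initial segment is uniformly distributed. *)
Definition fair_coins (R : realType) (d : measure_display)
    (T : measurableType d) (P : probability T R) (coin : nat -> T -> bool) :
    Prop :=
  (forall i, measurable_fun setT (coin i)) /\
  (forall w : seq bool,
     P [set x : T | forall i, (i < size w)%N -> coin i x = nth false w i]%classic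
     = ((2^-1) ^+ size w)%:E).

Definition log2 (R : realType) (x : R) : R := ln x / ln 2.

(* Main.v *)
Require Import Defs.
From HB Require Import structures.
From mathcomp Require Import all_boot all_order all_algebra.
From mathcomp Require Import all_classical all_reals all_analysis.
From mathcomp Require Import zify ring lra.
Import Defs.
Set Implicit Arguments.
Unset Strict Implicit.
Unset Printing Implicit Defensive.
Local Open Scope nat_scope.

(* A derandomized form of the two-step Fredman-Komlos-Szemeredi hashing.  Bob
   takes the least modulus m separating his strings.  Here m <= n k^2 + 2: if
   1, ..., M all divide the product of the pairwise differences, then so do the
   numbers M * 'C(M-1, j), whose sum over j is M 2^(M-1), and this product, which
   is at most 2^(n k^2), is at least 2^(M-1).  Then he takes the least odd
   multiplier a = 2g-1 for which x |-> (a x mod N) / Q, with N a power of two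
   above m and N / Q >= 2 k^2, separates the residues; for each pair of residues
   few odd multipliers fail, so some a < N works.  Bob sends m and g, about
   log n + 2 log k bits each, and Alice replies with l hash values of about
   2 log k bits.  Exhaustive search over the O(n k^2) candidates already fits in
   the time O(k^3 n^3), so Bob tosses no coin and his expected time is his time.

   A joint run consists of prefixes of two solo runs, in which each participant
   finds all of his or her incoming bits already in the inbox; it cannot deadlock
   because Bob reads only after having sent everything. *)

(** * Separating moduli and multipliers *)

(* U(n, m) := n.+1 * 'C(n, m) is the denominator of an entry of Leibniz' harmonic
   triangle, whence 1 / U(n, m.+1) = 1 / U(n.-1, m) - 1 / U(n, m). *)
Lemma dvdn_leibniz D n m :
  (forall j, 0 < j <= n.+1 -> j %| D) -> m <= n -> n.+1 * 'C(n, m) %| D.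
Proof.
elim: m n => [|m IHm] n divD; first by move=> _; rewrite bin0 muln1 divD ?leqnn.
case: n divD => // n divD lt_mn.
have /dvdnP[x Dx] : n.+2 * 'C(n.+1, m) %| D by apply: IHm divD _; lia.
have /dvdnP[y Dy] : n.+1 * 'C(n, m) %| D.
  by apply: IHm => // j /andP[j0 jn]; apply: divD; rewrite j0 leqW.
have E1 := mul_bin_diag n.+1 m; rewrite /= in E1.
have E2 := mul_bin_diag n.+2 m; rewrite /= in E2.
have E3 := binS n.+1 m.
have p1 : 0 < 'C(n.+1, m) by rewrite bin_gt0; lia.
have p2 : 0 < 'C(n, m) by rewrite bin_gt0; lia.
set a := n.+2 * 'C(n.+1, m) in Dx *; set b := n.+1 * 'C(n, m) in Dy *.
set c := _ * _.
(* The identity [1/c = 1/b - 1/a] with denominators cleared. Since [D = x * a = y * b], it makes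
   [y - x] the quotient of [D] by [c]. *)
have Eabc : c * a = a * b + c * b.
  have ->: a * b + c * b = b * (n.+2 * 'C(n.+2, m.+1)) by rewrite /a /c E3; ring.
  by rewrite /a /b /c E1 E2; ring.
have a0 : 0 < a by rewrite muln_gt0 p1.
have b0 : 0 < b by rewrite muln_gt0 p2.
apply/dvdnP; exists (y - x).
have ab0 : 0 < a * b by rewrite muln_gt0 a0.
apply/eqP; rewrite -(eqn_pmul2r ab0); apply/eqP.
have -> : (y - x) * c * (a * b) = c * a * (y * b) - c * b * (x * a).
  rewrite !mulnBl; congr (_ - _); ring.
by rewrite -Dx -Dy -mulnBl Eabc addnK mulnC.
Qed.

(** Nair's lower bound on the least common multiple of [1, ..., n.+1]: the [n.+1] numbers
    [n.+1 * 'C(n, m)] divide [D], so each is at most [D], and they sum to [n.+1 * 2 ^ n]. *)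
Lemma exp2_le_multiple D n :
  0 < D -> (forall j, 0 < j <= n.+1 -> j %| D) -> 2 ^ n <= D.
Proof.
move=> D0 divD; rewrite -(leq_pmul2l (ltn0Sn n)).
have -> : n.+1 * 2 ^ n = \sum_(m < n.+1) n.+1 * 'C(n, m).
  rewrite -[2]/(1 + 1) expnDn -big_distrr /=; congr (_ * _).
  by apply: eq_bigr => m _; rewrite !exp1n !muln1.
apply: (leq_trans (n := \sum_(m < n.+1) D)); last by rewrite sum_nat_const card_ord.
by apply: leq_sum => m _; apply: dvdn_leq => //; apply: dvdn_leibniz => //; rewrite -ltnS.
Qed.

(** If no [g] up to [b.+2] separates, each of them divides some difference and hence the product
    [D], so [2 ^ b.+1 <= D]. But [D] has [size v ^ 2] factors, each at most [2 ^ n]. *)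
Lemma separating_modulus n (v : seq nat) :
  uniq v -> {in v, forall x, x < 2 ^ n} ->
  exists2 g, 0 < g <= n * size v ^ 2 + 2 & uniq [seq x %% g | x <- v].
Proof.
move=> v_uniq v_lt; set b := n * size v ^ 2.
have [[g g_in g_uniq]|no_g] :=
  altP (@hasP _ (fun g => uniq [seq x %% g | x <- v]) (iota 1 b.+2)).
  by exists g => //; move: g_in; rewrite mem_iota; lia.
(* The factors 1 for [x >= y] keep [D] positive although subtraction is truncated. *)
pose D := \prod_(x <- v) \prod_(y <- v) (if x < y then y - x else 1).
have D0 : 0 < D.
  by apply: prodn_gt0 => x; apply: prodn_gt0 => y; case: ifP => //; rewrite subn_gt0.
have leD : D <= 2 ^ b.
  have -> : 2 ^ b = \prod_(x <- v) \prod_(y <- v) 2 ^ n.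
    by rewrite !big_const_seq !count_predT !iter_muln_1 -!expnM /b -mulnn mulnA.
  rewrite /D !big_seq; apply: leq_prod => x _; rewrite !big_seq; apply: leq_prod => y y_in.
  by case: ifP => _; [apply: leq_trans (leq_subr _ _) (ltnW (v_lt y y_in)) | rewrite expn_gt0].
suff divD : forall j, 0 < j <= b.+2 -> j %| D.
  by have := exp2_le_multiple D0 divD; rewrite expnS; have := expn_gt0 2 b; lia.
move=> j j_in; apply: contraT => jD; case/hasP: no_g; exists j; first by rewrite mem_iota; lia.
rewrite map_inj_in_uniq // => x y x_in y_in eqxy.
wlog lt_xy : x y x_in y_in eqxy / x < y.
  by move=> W; case: (ltngtP x y) => // /W H; [|symmetry]; apply: H.
case/negP: jD; rewrite /D (big_rem x) //=; apply: dvdn_mulr.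
rewrite (big_rem y) //= lt_xy; apply: dvdn_mulr.
by rewrite -eqn_mod_dvd 1?ltnW // eq_sym; apply/eqP.
Qed.

(* The difference hits [1, Q) for at most Q - 1 of the odd multipliers: halving
   an even d halves the modulus and the target, and doubles the number of
   periods. *)
Lemma count_odd_multiplier w d Q : ~~ (2 ^ w.+1 %| d) ->
  count (fun b => (b.*2.+1 * d) %% 2 ^ w.+1 < Q) (iota 0 (2 ^ w)) <= Q.-1.
Proof.
elim: w d Q => [|w IHw] d Q.
  rewrite expn1 dvdn2 negbK => d_odd /=; rewrite addn0 mul1n modn2 d_odd; lia.
(* For odd [d] the residues [f b] are pairwise distinct, and they are odd, hence nonzero: the
   counted [b] inject into [[1, Q)]. *)
case: (boolP (odd d)) => [d_odd _| d_even].
  pose f b := (b.*2.+1 * d) %% 2 ^ w.+2.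
  rewrite -[count _ _]/(count (fun b => f b < Q) _) -size_filter -(size_map f).
  rewrite -[X in _ <= X](size_iota 1); apply: uniq_leq_size.
    rewrite map_inj_in_uniq ?filter_uniq ?iota_uniq // => b b'.
    rewrite !mem_filter !mem_iota /= !add0n => /andP[_ b_lt] /andP[_ b'_lt].
    wlog le_b : b b' b_lt b'_lt / b <= b'.
      by move=> W eqf; case: (leqP b b') => [/W->|/ltnW /W H] //; symmetry; apply: H.
    move/eqP; rewrite eq_sym eqn_mod_dvd ?leq_mul2r ?ltnS ?leq_double ?le_b ?orbT //.
    rewrite -mulnBl Gauss_dvdl ?coprimeXl ?coprime2n // subSS -doubleB expnS mul2n.
    rewrite -!muln2 dvdn_pmul2r // => dv; have [//|lt_b] : b = b' \/ b < b' by lia.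
    have := dvdn_leq _ dv; lia.
  move=> v /mapP[b]; rewrite mem_filter => /andP[ltQ _] ->.
  suff : 0 < f b by rewrite mem_iota; lia.
  rewrite lt0n; apply/negP => /(dvdn_trans (dvdn_exp (ltn0Sn _) (dvdnn 2))).
  by rewrite dvdn2 oddM d_odd andbT /= odd_double.
move=> d_ndvd; have d2_ndvd : ~~ (2 ^ w.+1 %| d./2).
  move: d_ndvd; rewrite -{1}(even_halfK d_even) -muln2 (expnSr _ w.+1).
  by rewrite dvdn_pmul2r.
(* [2 * v < Q] amounts to [v < uphalf Q]; the two periods together contribute at most
   [2 * (uphalf Q).-1 <= Q.-1]. *)
set Q2 := uphalf Q.
have half b : (b.*2.+1 * d) %% 2 ^ w.+2 < Q = ((b.*2.+1 * d./2) %% 2 ^ w.+1 < Q2).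
  have {1}-> : d = d./2 * 2 by rewrite muln2 even_halfK.
  rewrite mulnA (expnSr _ w.+1) -muln_modl muln2 /Q2; lia.
have iota2 : iota 0 (2 ^ w.+1) = iota 0 (2 ^ w) ++ map (addn (2 ^ w)) (iota 0 (2 ^ w)).
  by rewrite -iotaDl addn0 -iotaD expnS mul2n addnn.
rewrite (eq_count half) iota2 count_cat count_map.
have per b : ((2 ^ w + b).*2.+1 * d./2) %% 2 ^ w.+1 = (b.*2.+1 * d./2) %% 2 ^ w.+1.
  have -> : (2 ^ w + b).*2.+1 * d./2 = d./2 * 2 ^ w.+1 + b.*2.+1 * d./2.
    by rewrite expnS -!mul2n -addn1 -(addn1 (2 * b)); ring.
  by rewrite modnMDl.
rewrite [X in _ + X](eq_count (a2 := fun b => (b.*2.+1 * d./2) %% 2 ^ w.+1 < Q2)); last first.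
  by move=> b /=; rewrite per.
by have := IHw d./2 Q2 d2_ndvd; rewrite /Q2; lia.
Qed.

(** Multiplicative hashing with the odd multiplier [2g - 1]. Numbering the multipliers from [g = 1]
    lets one search, starting at 1, serve for moduli and multipliers alike. *)
Definition odd_multiply_shift N Q g x := (((g + g - 1) * x) %% N) %/ Q.

(** Union bound. A collision of [x] and [y] puts an odd multiple of [x - y] or of [y - x] into
    [[0, Q)] modulo [N]. Each ordered pair spoils at most [Q - 1] of the [2 ^ w] multipliers, and
    [2 ^ w = 2 ^ s * Q / 2 >= size r ^ 2 * Q]. *)
Lemma separating_odd_multiplier w s (r : seq nat) :
  uniq r -> {in r, forall x, x < 2 ^ w.+1} -> s <= w.+1 -> 2 * size r ^ 2 <= 2 ^ s ->
  exists2 g, 0 < g <= 2 ^ w &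
    uniq [seq odd_multiply_shift (2 ^ w.+1) (2 ^ (w.+1 - s)) g x | x <- r].
Proof.
move=> r_uniq r_lt le_sw leS; set N := 2 ^ w.+1; set Q := 2 ^ (w.+1 - s).
have N0 : 0 < N by rewrite expn_gt0.
have Q0 : 0 < Q by rewrite expn_gt0.
(* [x + N - y] represents [x - y] modulo [N] without truncation; the index [b] stands for the
   multiplier [2b + 1], that is, for [g = b + 1]. *)
pose bad b x y := (x != y) && ((b.*2.+1 * (x + N - y)) %% N < Q).
have [[b b_in /allP b_ok]|no_b] := altP (@hasP _
  (fun b => all (fun x => all (fun y => ~~ bad b x y) r) r) (iota 0 (2 ^ w))).
  exists b.+1; first by move: b_in; rewrite mem_iota; lia.
  rewrite map_inj_in_uniq // => x y x_in y_in.
  rewrite /odd_multiply_shift addSn subn1 /= addnS addnn.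
  wlog le_yx : x y x_in y_in / (b.*2.+1 * y) %% N <= (b.*2.+1 * x) %% N.
    move=> W eqh; case: (leqP ((b.*2.+1 * y) %% N) ((b.*2.+1 * x) %% N)).
      by move=> /W; apply.
    by move=> /ltnW /W H; symmetry; apply: H.
  move=> eqh; apply/eqP; have /allP/(_ y y_in) := b_ok x x_in.
  rewrite /bad; case: eqP => //= _; rewrite -leqNgt => leQ.
  (* Equal hash values place both residues in the same block of length [Q]. *)
  have lt_diff : (b.*2.+1 * x) %% N - (b.*2.+1 * y) %% N < Q.
    rewrite [X in X - _](divn_eq _ Q) [X in _ - X](divn_eq _ Q) eqh subnDl.
    by rewrite (leq_ltn_trans (leq_subr _ _)) ?ltn_pmod.
  suff E : b.*2.+1 * (x + N - y) = (b.*2.+1 * x) %% N - (b.*2.+1 * y) %% N %[mod N].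
    move: leQ; rewrite E modn_small; first by rewrite leqNgt lt_diff.
    by rewrite (leq_ltn_trans (leq_subr _ _)) ?ltn_pmod.
  apply/eqP; rewrite -(eqn_modDr (b.*2.+1 * y)); apply/eqP.
  rewrite -mulnDr subnK; last exact: leq_trans (ltnW (r_lt y y_in)) (leq_addl _ _).
  by rewrite -[RHS]modnDmr subnK // modn_mod mulnDr addnC modnMDl.
suff : 2 ^ w <= size r ^ 2 * Q.-1.
  have EN : N = 2 ^ s * Q by rewrite -expnD subnKC.
  move: EN leS Q0; rewrite /N expnS => EN leS Q0.
  have r0 : 0 < size r ^ 2 \/ size r ^ 2 = 0 by lia.
  have : 0 < 2 ^ w by rewrite expn_gt0.
  nia.
have -> : 2 ^ w = \sum_(b <- iota 0 (2 ^ w)) 1 by rewrite sum1_size size_iota.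
apply: (leq_trans (n := \sum_(b <- iota 0 (2 ^ w)) \sum_(x <- r) \sum_(y <- r) bad b x y)).
  rewrite !big_seq; apply: leq_sum => b b_in.
  have : ~~ all (fun x => all (fun y => ~~ bad b x y) r) r.
    by apply/negP => H; case/hasP: no_b; exists b.
  rewrite -has_predC => /hasP[x x_in /=]; rewrite -has_predC => /hasP[y y_in /=].
  by rewrite negbK => H; rewrite (big_rem x) //= (big_rem y) //= H -!addnA leq_addr.
rewrite exchange_big /=.
have -> : size r ^ 2 * Q.-1 = \sum_(x <- r) \sum_(y <- r) Q.-1.
  by rewrite !big_const_seq !count_predT !iter_addn_0 -mulnn; lia.
rewrite !big_seq; apply: leq_sum => x x_in; rewrite exchange_big /=.
rewrite !big_seq; apply: leq_sum => y y_in.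
case: (eqVneq x y) => [<-|ne_xy].
  by rewrite big1 // => b _; rewrite /bad eqxx.
rewrite -[X in X <= _]/(\sum_(b <- _) _) (eq_bigr (fun b => nat_of_bool ((b.*2.+1 * (x + N - y)) %% N < Q))).
  rewrite -big_mkcond /= sum1_count; apply: count_odd_multiplier.
  have x_lt := r_lt x x_in; have y_lt := r_lt y y_in; rewrite -/N in x_lt y_lt *.
  case: (ltnP x y) => [lt_xy|le_yx].
    by apply/negP => /dvdn_leq; lia.
  rewrite addnC -addnBA // -/N /dvdn modnDl -/(dvdn _ _).
  by apply/negP => /dvdn_leq; lia.
by move=> b _; rewrite /bad ne_xy.
Qed.

(** * Solo runs and joint runs *)

Definition no_coin : nat -> bool := fun=> false.

Definition at_recv (p : party) : bool :=
  if control p is Recv _ :: _ then true else false.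

Definition active (p : party) : bool :=
  ~~ halted p && (at_recv p ==> (inbox p != [::])).

Definition solo_step (Po : party * seq bool) : party * seq bool :=
  let: (p, o) := Po in let: (q, msg) := step no_coin p in (q, o ++ msg).

(* A run of one participant all of whose incoming bits are already in the inbox;
   [ok] restricts the outputs produced before a bit may be read. *)
Fixpoint solo (ok : seq bool -> Prop) (N : nat) (P P' : party * seq bool) : Prop :=
  if N is N'.+1 then
    [/\ active P.1, at_recv P.1 -> ok P.2 & solo ok N' (solo_step P) P']
  else P = P'.

Lemma cat_inj (T : Type) (s : seq T) : injective (cat s).
Proof. by elim: s => //= x s IHs u v [/IHs]. Qed.

Lemma solo_trans ok N N' P P' P'' :
  solo ok N P P' -> solo ok N' P' P'' -> solo ok (N + N') P P''.
Proof.
elim: N P => [|N IHN] P /=; first by move->.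
by case=> ? ? H ?; split=> //; apply: IHN H _.
Qed.

Lemma deliver_nil p : deliver p [::] = p.
Proof. by case: p => *; rewrite /deliver /= cats0. Qed.

Lemma deliver_cat p x y : deliver (deliver p x) y = deliver p (x ++ y).
Proof. by rewrite /deliver /= catA. Qed.

(** A step reads at the front of the inbox while delivery appends at the back, so late delivery
    commutes with any step that is not idle. *)
Lemma step_deliver p x : active p ->
  step no_coin (deliver p x) = (deliver (step no_coin p).1 x, (step no_coin p).2).
Proof.
case: p => ctl s ib f m t; rewrite /active /halted /at_recv /=.
by case: ctl => [|[]] //= ? ?; case: ib.
Qed.

Lemma step_inactive p : ~~ active p -> step no_coin p = (p, [::]).
Proof.
case: p => ctl s ib f m t; rewrite /active /halted /at_recv /=.
by case: ctl => [|[]] //= ? ?; case: ib.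
Qed.

Lemma step_mono p :
  time p <= time (step no_coin p).1 /\ sent p <= sent (step no_coin p).1.
Proof.
case: p => ctl s ib f m t.
by case: ctl => [|[]] //= *; try case: ib => //= *; rewrite ?addnS ?leqnSn; split; lia.
Qed.

Arguments step : simpl never.

Lemma halted_inactive p : halted p -> ~~ active p.
Proof. by rewrite /active => ->. Qed.

Lemma solo_mono ok N P P' : solo ok N P P' ->
  [/\ time P.1 <= time P'.1, sent P.1 <= sent P'.1 & exists x, P'.2 = P.2 ++ x].
Proof.
elim: N P => [|N IHN] [p o] /=; first by move<-; split=> //; exists [::]; rewrite cats0.
case=> _ _; have [] := step_mono p; case: (step _ p) => q msg /= le1 le2 /IHN /=.
case=> le3 le4 [x ->]; split; [lia | lia | by exists (msg ++ x); rewrite catA].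
Qed.

Lemma solo_halted ok N p o F o' :
  solo ok N (p, o) (F, o') -> halted p -> [/\ p = F & o = o'].
Proof. by case: N => [|N] /=; [case=> -> -> | case; rewrite /active /= => /andP[/negP]]. Qed.

(** [rest] is what the solo inbox holds beyond the bits that have arrived. An active step of [p] is
    a step of the solo run; an idle one leaves that run where it is. *)
Lemma solo_advance ok N p rest o F full : halted F ->
  solo ok N (deliver p rest, o) (F, full) ->
  exists N', [/\ solo ok N' (deliver (step no_coin p).1 rest, o ++ (step no_coin p).2) (F, full),
                 N' <= N & active p -> N' < N].
Proof.
move=> haltF; case: (boolP (active p)) => [act|inact]; last first.
  by rewrite step_inactive //= cats0; exists N.
case: N => [|N] /=.
  by case=> E _; case/andP: act => /negP[]; rewrite -E in haltF.
by case=> _ _; rewrite step_deliver // => H; exists N; split.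
Qed.

Section Joint.
Variables (okA : seq bool -> Prop) (PA PB FA FB : party) (inA inB : seq bool).
Variables (TA TB : nat).
Hypotheses (haltA : halted FA) (haltB : halted FB).
Hypothesis soloA : solo okA TA (deliver PA inA, [::]) (FA, inB).
Hypothesis soloB : solo (fun o => o = inA) TB (deliver PB inB, [::]) (FB, inA).

Let jrun t := iter t (joint_step no_coin no_coin) (PA, PB).

(** [outA] and [outB] are the bits sent so far, [restA] and [restB] those that Alice and Bob still
    lack. [NA + NB] solo steps remain, and this number falls with every joint step until both have
    halted. *)
Let invariant (AB : party * party) t := exists NA NB outA outB restA restB,
  [/\ solo okA NA (deliver AB.1 restA, outA) (FA, inB),
      solo (fun o => o = inA) NB (deliver AB.2 restB, outB) (FB, inA),
      outB ++ restA = inA, outA ++ restB = inB &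
      (halted AB.1 && halted AB.2) || (NA + NB + t <= TA + TB)].

(** There is no deadlock. A Bob who has halted or waits has sent everything, so Alice has her whole
    inbox and, being inactive, has halted. Her output is then complete, so Bob cannot be waiting. *)
Let progress A B NA NB outA outB restA restB :
  solo okA NA (deliver A restA, outA) (FA, inB) ->
  solo (fun o => o = inA) NB (deliver B restB, outB) (FB, inA) ->
  outB ++ restA = inA -> outA ++ restB = inB ->
  ~~ active A -> ~~ active B -> halted A && halted B.
Proof.
move=> sA sB EA EB iA iB.
have nilrest (o r : seq bool) : o ++ r = o -> r = [::].
  by move=> /(congr1 size); rewrite size_cat => E; apply/nilP; rewrite /nilp; lia.
have A_done : outB = inA -> halted A /\ outA = inB.
  move=> E; have r0 := nilrest outB restA; rewrite EA E in r0.
  move: sA; rewrite r0 // deliver_nil; case: NA => [[-> ->]//|N /= [act]].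
  by rewrite act in iA.
have [hB|nhB] := boolP (halted B).
  by have [_ /A_done[->]] := solo_halted sB hB.
case: NB sB => [[E]|N /= [act ok _]]; first by move: nhB haltB; rewrite -E /halted /= => /negPf->.
have : at_recv B by move: iB; rewrite /active nhB /=; case: at_recv.
move=> /ok /A_done[_ E]; have r0 := nilrest outA restB; rewrite EB E in r0.
by move: act iB; rewrite r0 // deliver_nil => ->.
Qed.

Let invariantP t : invariant (jrun t) t.
Proof.
elim: t => [|t].
  exists TA, TB, [::], [::], inA, inB; split=> //; by rewrite addn0 leqnn orbT.
rewrite /jrun iterS -/(jrun t); case: (jrun t) => A B.
case=> NA [NB [outA [outB [restA [restB [/= sA sB EA EB Ht]]]]]].
have [NA' [sA' leA ltA]] := solo_advance haltA sA.
have [NB' [sB' leB ltB]] := solo_advance haltB sB.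
have := progress sA sB EA EB.
rewrite /joint_step /=.
have iA := @step_inactive A; have iB := @step_inactive B.
case: (step _ A) iA sA' => A' msgA /= iA sA'; case: (step _ B) iB sB' => B' msgB /= iB sB' prog.
have [_ _ [xA /= ExA]] := solo_mono sA'; have [_ _ [xB /= ExB]] := solo_mono sB'.
(* Cancelling [outA] shows that the new message is the front of what Bob lacks, so delivering it and
   keeping [xA] preserves his solo state. *)
have E2 : restB = msgA ++ xA.
  by apply: (@cat_inj _ outA); rewrite EB ExA catA.
have E1 : restA = msgB ++ xB.
  by apply: (@cat_inj _ outB); rewrite EA ExB catA.
exists NA', NB', (outA ++ msgA), (outB ++ msgB), xB, xA.
rewrite !deliver_cat -!catA -E1 -E2; split=> //=.
have [hAB|not_halted] := boolP (halted A && halted B).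
  have /andP[hA hB] := hAB.
  have [-> _] := iA (halted_inactive hA); have [-> _] := iB (halted_inactive hB).
  by rewrite hAB.
move: Ht; rewrite (negPf not_halted) /= => Ht; apply/orP; right.
have [/ltA|nA] := boolP (active A); first lia.
have [/ltB|nB] := boolP (active B); first lia.
by move: not_halted; rewrite prog.
Qed.

Lemma joint_run_safe t :
  [/\ time (jrun t).1 <= time FA, time (jrun t).2 <= time FB,
      sent (jrun t).1 <= sent FA & sent (jrun t).2 <= sent FB].
Proof.
have [NA [NB [outA [outB [restA [restB [sA sB _ _ _]]]]]]] := invariantP t.
by have [? ? _] := solo_mono sA; have [? ? _] := solo_mono sB.
Qed.

Lemma joint_run_haltedA t : halted (jrun t).1 ->
  memory (jrun t).1 = memory FA /\ sent (jrun t).1 = sent FA.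
Proof.
have [NA [NB [outA [outB [restA [restB [sA _ _ _ _]]]]]]] := invariantP t.
by move=> h; have [<- _] := solo_halted sA h.
Qed.

Lemma joint_run_haltedB t : halted (jrun t).2 ->
  memory (jrun t).2 = memory FB /\ sent (jrun t).2 = sent FB.
Proof.
have [NA [NB [outA [outB [restA [restB [_ sB _ _ _]]]]]]] := invariantP t.
by move=> h; have [<- _] := solo_halted sB h.
Qed.

Lemma joint_run_halts : exists t, halted (jrun t).1 && halted (jrun t).2.
Proof.
(* One step more than the two solo runs contain, so the counting alternative of the invariant is
   impossible. *)
exists (TA + TB).+1.
have [NA [NB [outA [outB [restA [restB [_ _ _ _]]]]]]] := invariantP (TA + TB).+1.
by case/orP => // ?; lia.
Qed.

End Joint.

Lemma step_flip_free coin p : all flip_free (control p) ->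
  step coin p = step no_coin p /\ all flip_free (control (step no_coin p).1).
Proof.
case: p => ctl s ib f m t; rewrite /step /=.
case: ctl => [|[|x e|a i e|c1 c2|e c1 c2|e c1|x|e|x] ctl] //=.
- by rewrite -andbA => /and3P[-> -> ->].
- by move=> /andP[/andP[h1 h2] ->]; case: ifP; rewrite ?h1 ?h2.
- by move=> /andP[h1 h2]; case: ifP; rewrite /= ?h1 ?h2.
by case: ib.
Qed.

(** Reduces all outcomes of Bob's random bits to a single deterministic run. *)
Lemma joint_run_coin coin A B t :
  all flip_free (control A) -> all flip_free (control B) ->
  iter t (joint_step no_coin coin) (A, B) = iter t (joint_step no_coin no_coin) (A, B).
Proof.
move=> ffA ffB; set J := iter t (joint_step no_coin no_coin) (A, B).
suff [] : [/\ iter t (joint_step no_coin coin) (A, B) = J,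
  all flip_free (control J.1) & all flip_free (control J.2)] by [].
rewrite /J {J}; elim: t => [//|t] /=; case: (iter t (joint_step no_coin no_coin) _) => A' B' /=.
case=> -> hA hB; rewrite /joint_step /=.
have [_ ] := step_flip_free no_coin hA; have [-> ] := step_flip_free coin hB.
by case: (step no_coin A') => ? ?; case: (step no_coin B') => ? ? /= -> ->.
Qed.

(** * Time-bounded weakest preconditions *)

(** A constant up to 3 has at most two bits, so multiplying or dividing by it has linear instead of
    quadratic cost. The inner loops owe their speed to this. *)
Definition linear_op (o : binop) (e2 : expr) : bool :=
  match o, e2 with
  | (Mul | Div | Mod), Cst c => c <= 3
  | (Mul | Div | Mod), _ => false
  | _, _ => true
  end.

Fixpoint linear_expr (e : expr) : bool :=
  match e with
  | Cst _ | Reg _ => true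
  | Get _ i => linear_expr i
  | Bin o e1 e2 => [&& linear_op o e2, linear_expr e1 & linear_expr e2]
  end.

Fixpoint expr_weight (e : expr) : nat :=
  match e with
  | Cst _ | Reg _ => 1
  | Get _ i => expr_weight i + 2
  | Bin o e1 e2 => expr_weight e1 + expr_weight e2 + 2
  end.

Section Triples.
Variable ok : seq bool -> Prop.

(** Quantifying over the continuation [k] and the clock [t] makes runs composable. The counter
    [sent] is tied to the length of the output. *)
Definition runs c s ib o s' ib' o' T := forall k t, exists N t',
  t' <= t + T /\
  solo ok N (Party (c :: k) s ib 0 (size o) t, o) (Party k s' ib' 0 (size o') t', o').

(** [tau] is the time bound accumulated before [c]. As [T] is only an upper bound, every rule may
    charge a round figure. *)
Definition wp c s ib o tau (Q : store -> seq bool -> seq bool -> nat -> Prop) :=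
  exists s' ib' o' T, runs c s ib o s' ib' o' T /\ Q s' ib' o' (tau + T).

Lemma runs_seq c1 c2 s ib o s1 ib1 o1 T1 s2 ib2 o2 T2 :
  runs c1 s ib o s1 ib1 o1 T1 -> runs c2 s1 ib1 o1 s2 ib2 o2 T2 ->
  runs (Seq c1 c2) s ib o s2 ib2 o2 (T1 + T2 + 1).
Proof.
move=> r1 r2 k t.
have [N1 [t1 [le1 S1]]] := r1 (c2 :: k) t.+1; have [N2 [t2 [le2 S2]]] := r2 k t1.
exists (N1 + N2).+1, t2; split; first lia.
by split=> //=; rewrite cats0; apply: solo_trans S1 S2.
Qed.

Lemma runs_step c s ib s' ib' o o' T :
  (forall k t, exists2 t', t' <= t + T &
     [/\ active (Party (c :: k) s ib 0 (size o) t), at_recv (Party (c :: k) s ib 0 (size o) t) -> ok o &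
     solo_step (Party (c :: k) s ib 0 (size o) t, o) = (Party k s' ib' 0 (size o') t', o')]) ->
  runs c s ib o s' ib' o' T.
Proof.
by move=> H k t; have [t' le_t' [? ? E]] := H k t; exists 1, t'; split.
Qed.

Lemma wp_step c s ib o tau Q s' ib' o' T :
  runs c s ib o s' ib' o' T -> Q s' ib' o' (tau + T) -> wp c s ib o tau Q.
Proof. by move=> r q; exists s', ib', o', T. Qed.

Lemma wp_skip s ib o tau (Q : _ -> _ -> _ -> _ -> Prop) :
  Q s ib o (tau + 1) -> wp Skip s ib o tau Q.
Proof.
apply: wp_step; apply: runs_step => k t; exists t.+1; first lia.
by split; rewrite //= cats0.
Qed.

Lemma wp_seq c1 c2 s ib o tau (Q : _ -> _ -> _ -> _ -> Prop) :
  wp c1 s ib o (tau + 1) (fun s' ib' o' tau' => wp c2 s' ib' o' tau' Q) ->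
  wp (Seq c1 c2) s ib o tau Q.
Proof.
case=> [s1 [ib1 [ o1 [T1 [r1 [s2 [ib2 [ o2 [T2 [r2 q]]]]]]]]]].
apply: wp_step (runs_seq r1 r2) _.
by have -> : tau + (T1 + T2 + 1) = tau + 1 + T1 + T2 by lia.
Qed.

Lemma wp_recv x (b : bool) s ib o tau (Q : _ -> _ -> _ -> _ -> Prop) : ok o ->
  Q (set_reg s x b) ib o (tau + 1) -> wp (Recv x) s (b :: ib) o tau Q.
Proof.
move=> oko; apply: wp_step; apply: runs_step => k t; exists t.+1; first lia.
by split; rewrite //= cats0.
Qed.

Lemma wp_weaken c s ib o tau (Q Q' : _ -> _ -> _ -> _ -> Prop) :
  wp c s ib o tau Q -> (forall s' ib' o' tau', Q s' ib' o' tau' -> Q' s' ib' o' tau') ->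
  wp c s ib o tau Q'.
Proof.
by move=> [s' [ib' [ o' [T [r q]]]]] H; apply: wp_step r (H _ _ _ _ q).
Qed.

End Triples.

Section WeakestPrecondition.
(* All values computed stay below [B]; [beta] bounds the length of a value. *)
Variables (B beta : nat).
Hypotheses (B4 : 4 <= B) (B_beta : bitlen B <= beta).
Variable ok : seq bool -> Prop.
Notation wp := (wp ok).
Notation runs := (runs ok).

Definition expr_cap e : nat :=
  expr_weight e * (if linear_expr e then beta else beta * beta).

(** Only [Add] and [Mul] can exceed their operands; a comparison yields at most 1, so the remaining
    operations carry no condition. *)
Fixpoint bounded (s : store) (e : expr) : Prop :=
  match e with
  | Cst v => v <= B
  | Reg x => reg s x <= B
  | Get a i => bounded s i /\ arr s a (eval s i) <= B
  | Bin o e1 e2 =>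
      [/\ bounded s e1, bounded s e2 &
          if o is (Add | Mul) then op_val o (eval s e1) (eval s e2) <= B else true]
  end.

Lemma bounded_eval s e : bounded s e -> eval s e <= B.
Proof.
elim: e => [v|x|a e IHe|o e1 IH1 e2 IH2] //=; first by case.
case=> /IH1 le1 /IH2 le2; case: o => //= _.
- exact: leq_trans (leq_subr _ _) le1.
- exact: leq_trans (leq_div _ _) le1.
- exact: leq_trans (leq_mod _ _) le1.
- by apply: leq_trans (leq_b1 _) _; lia.
- by apply: leq_trans (leq_b1 _) _; lia.
Qed.

Lemma beta_gt0 : 0 < beta.
Proof. exact: leq_trans B_beta. Qed.

Lemma bitlen_beta v : v <= B -> bitlen v <= beta.
Proof. by move=> le_vB; apply: leq_trans B_beta; rewrite ltnS leq_trunc_log. Qed.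

Lemma ecost_cap s e : bounded s e -> ecost s e <= expr_cap e.
Proof.
rewrite /expr_cap; have b0 := beta_gt0.
have leb2 : beta <= beta * beta by rewrite leq_pmulr.
elim: e => [v|x|a e IHe|o e1 IH1 e2 IH2] /=.
- by move/bitlen_beta; rewrite mul1n.
- by move/bitlen_beta; rewrite mul1n.
- case=> okE le_v; have := IHe okE; have := bitlen_beta le_v.
  by have := bitlen_beta (bounded_eval okE); case: linear_expr; nia.
case=> ok1 ok2 _; have l1 := bitlen_beta (bounded_eval ok1).
have l2 := bitlen_beta (bounded_eval ok2).
have m12 := leq_mul l1 l2.
have {IH1} := IH1 ok1; have {IH2} := IH2 ok2.
case: (linear_expr e1); case: (linear_expr e2); rewrite ?andbT ?andbF; try
  by case: o => /=; nia.
case: ifP => [lin|_]; last by case: o => /=; nia.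
case: o lin; rewrite /linear_op /op_cost; try nia.
all: case: e2 l2 m12 ok2 => // c l2 m12 ok2 c3 /=.
all: have : bitlen c <= 2 by rewrite ltnS (leq_trans (leq_trunc_log 2 c3)).
all: nia.
Qed.

Lemma wp_assign x e s ib o tau (Q : _ -> _ -> _ -> _ -> Prop) : bounded s e ->
  Q (set_reg s x (eval s e)) ib o (tau + (expr_cap e + 2 * beta)) ->
  wp (Assign x e) s ib o tau Q.
Proof.
move=> okE; apply: wp_step; apply: runs_step => k t.
exists (t + (ecost s e + bitlen (eval s e)).+1); last by split; rewrite //= cats0.
have := ecost_cap okE; have := bitlen_beta (bounded_eval okE); have := beta_gt0; lia.
Qed.

Lemma wp_put a i e s ib o tau (Q : _ -> _ -> _ -> _ -> Prop) :
  bounded s i -> bounded s e ->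
  Q (set_arr s a (eval s i) (eval s e)) ib o (tau + (expr_cap i + expr_cap e + 3 * beta)) ->
  wp (Put a i e) s ib o tau Q.
Proof.
move=> okI okE; apply: wp_step; apply: runs_step => k t; eexists; last first.
  by split; rewrite //= cats0.
have := ecost_cap okE; have := bitlen_beta (bounded_eval okE).
have := ecost_cap okI; have := bitlen_beta (bounded_eval okI); have := beta_gt0; lia.
Qed.

Lemma wp_if e c1 c2 s ib o tau (Q : _ -> _ -> _ -> _ -> Prop) : bounded s e ->
  wp (if eval s e != 0 then c1 else c2) s ib o (tau + (expr_cap e + beta)) Q ->
  wp (If e c1 c2) s ib o tau Q.
Proof.
move=> okE [s1 [ib1 [ o1 [T1 [r1 q]]]]].
apply: (wp_step (s' := s1) (ib' := ib1) (o' := o1) (T := expr_cap e + beta + T1)).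
  move=> k t; have [N1 [t1 [le1 S1]]] := r1 k (t + (ecost s e).+1).
  exists N1.+1, t1; split; last by split=> //=; rewrite cats0.
  have := ecost_cap okE; have := beta_gt0; lia.
by rewrite addnA.
Qed.

Lemma wp_send e s ib o tau (Q : _ -> _ -> _ -> _ -> Prop) : bounded s e ->
  Q s ib (rcons o (eval s e != 0)) (tau + (expr_cap e + beta)) ->
  wp (Send e) s ib o tau Q.
Proof.
move=> okE; apply: wp_step; apply: runs_step => k t; eexists; last first.
  by split; rewrite //= cats1 size_rcons.
have := ecost_cap okE; have := beta_gt0; lia.
Qed.

(** The invariant is indexed by the number of finished rounds and the guard holds exactly while this
    number is below [n], which gives termination and the time bound together, by induction on the
    rounds left. *)
Lemma wp_while (I : nat -> store -> seq bool -> seq bool -> Prop) n K e c s ib o tau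
    (Q : _ -> _ -> _ -> _ -> Prop) :
  (forall i s ib o, i <= n -> I i s ib o -> bounded s e /\ (eval s e != 0) = (i < n)) ->
  (forall i s ib o tau, i < n -> I i s ib o ->
     wp c s ib o tau (fun s' ib' o' tau' => I i.+1 s' ib' o' /\ tau' <= tau + K)) ->
  I 0 s ib o ->
  (forall s' ib' o' tau', I n s' ib' o' ->
     tau' <= tau + (n * (K + expr_cap e + beta) + expr_cap e + beta) -> Q s' ib' o' tau') ->
  wp (While e c) s ib o tau Q.
Proof.
move=> Icond Ibody I0 IQ.
have b0 := beta_gt0.
suff [s' [ib' [ o' [T [r [In leT]]]]]] : exists s' ib' o' T,
    runs (While e c) s ib o s' ib' o' T /\
    (I n s' ib' o' /\ T <= n * (K + expr_cap e + beta) + expr_cap e + beta).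
  by apply: wp_step r _; apply: IQ => //; rewrite leq_add2l.
have Hn : 0 + n = n by [].
move: I0; move: {1 4}n Hn => m; move: 0 => i.
elim: m i s ib o => [|m IHm] i s ib o Ein Ii.
  have [okE cond] := Icond i s ib o ltac:(lia) Ii.
  exists s, ib, o, (expr_cap e + beta); split; last by rewrite -Ein addn0; split.
  apply: runs_step => k t; eexists; last first.
    by split; rewrite //= cats0 cond -Ein addn0 ltnn.
  have := ecost_cap okE; lia.
have [okE cond] := Icond i s ib o ltac:(lia) Ii.
have i_lt : i < n by lia.
have [s1 [ib1 [ o1 [T1 [r1 [I1 leT1]]]]]] := Ibody i s ib o 0 i_lt Ii.
have [s2 [ib2 [ o2 [T2 [r2 [I2 leT2]]]]]] := IHm i.+1 s1 ib1 o1 ltac:(lia) I1.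
exists s2, ib2, o2, (expr_cap e + beta + T1 + T2); split; last by split=> //; lia.
move=> k t.
have [N1 [t1 [le1 S1]]] := r1 (While e c :: k) (t + (ecost s e).+1).
have [N2 [t2 [le2 S2]]] := r2 k t1.
exists (N1 + N2).+1, t2; split; first by have := ecost_cap okE; lia.
by split=> //=; rewrite cats0 cond i_lt; apply: solo_trans S1 S2.
Qed.

End WeakestPrecondition.

(** * The subroutines *)

(* Registers: 0-2 n, k, l; 3-6 scratch (3 a counter or power of two, 4 the value
   being computed or transmitted, 5 a bound or modulus, 6 a received bit); 7 and 8
   input and output addresses; 9 string index; 10 N; 11 N / Q; 12 Q; 13 m; 14 g,
   both for Alice; 15 round of the current search; 16 no collision in this round.
   Bob's arrays: 2 and 5 marks of the two searches; 3 residues; 4 inverse of the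
   hash function. *)
Definition ram (rs : seq nat) (A : nat -> nat -> nat) : store := Store (nth 0 rs) A.

Lemma set_reg_ram rs A x v : set_reg (ram rs A) x v = ram (set_nth 0 rs x v) A.
Proof. by rewrite /set_reg /ram; congr Store; apply/funext => y; rewrite nth_set_nth. Qed.

Definition upd (A : nat -> nat -> nat) a i v : nat -> nat -> nat :=
  fun b j => if (b == a) && (j == i) then v else A b j.

Lemma set_arr_ram rs A a i v : set_arr (ram rs A) a i v = ram rs (upd A a i v).
Proof. by []. Qed.

(** Leaves in register 3 the least power of two that is at least register 5. *)
Definition power_loop : com :=
  Seq (Assign 3 (Cst 1))
      (While (Bin Lt (Reg 3) (Reg 5)) (Assign 3 (Bin Add (Reg 3) (Reg 3)))).

(** Least significant bit first. The counter in register 3 runs through powers of two, so register 5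
    holds [2 ^ w] in place of the width [w], and a receiver can add register 3 itself for each bit
    that is set. *)
Definition send_loop : com :=
  Seq (Assign 3 (Cst 1))
      (While (Bin Lt (Reg 3) (Reg 5))
        (Seq (Send (Bin Mod (Reg 4) (Cst 2)))
        (Seq (Assign 4 (Bin Div (Reg 4) (Cst 2)))
             (Assign 3 (Bin Add (Reg 3) (Reg 3)))))).

Definition recv_loop : com :=
  Seq (Assign 4 (Cst 0))
  (Seq (Assign 3 (Cst 1))
      (While (Bin Lt (Reg 3) (Reg 5))
        (Seq (Recv 6)
        (Seq (If (Reg 6) (Assign 4 (Bin Add (Reg 4) (Reg 3))) Skip)
             (Assign 3 (Bin Add (Reg 3) (Reg 3))))))).

(** Horner's rule, most significant bit first. From [r < bd] one gets [2r + 1 < 2bd], so one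
    conditional subtraction replaces a division, and a string costs [n] rounds of linear cost. *)
Definition residue_loop : com :=
  Seq (Assign 4 (Cst 0))
  (Seq (Assign 3 (Cst 0))
      (While (Bin Lt (Reg 3) (Reg 0))
        (Seq (Assign 4 (Bin Add (Bin Add (Reg 4) (Reg 4)) (Get 0 (Reg 7))))
        (Seq (If (Bin Lt (Reg 4) (Reg 5)) Skip (Assign 4 (Bin Sub (Reg 4) (Reg 5))))
        (Seq (Assign 7 (Bin Add (Reg 7) (Cst 1)))
             (Assign 3 (Bin Add (Reg 3) (Cst 1)))))))).

Definition copy_loop : com :=
  Seq (Assign 3 (Cst 0))
      (While (Bin Lt (Reg 3) (Reg 0))
        (Seq (Put 1 (Reg 8) (Get 0 (Reg 7)))
        (Seq (Assign 7 (Bin Add (Reg 7) (Cst 1)))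
        (Seq (Assign 8 (Bin Add (Reg 8) (Cst 1)))
             (Assign 3 (Bin Add (Reg 3) (Cst 1))))))).

Definition bits w v : seq bool := mkseq (fun i => odd (v %/ 2 ^ i)) w.

Fixpoint string_value (f : nat -> nat) p i : nat :=
  if i is j.+1 then string_value f p j + string_value f p j + f (p + j) else 0.

Lemma up_log_lt w i : (2 ^ i < w) = (i < up_log 2 w).
Proof.
apply/idP/idP => [lt_w|lt_i].
  by rewrite -(ltn_exp2l (m := 2)) // (leq_trans lt_w) ?up_logP.
by rewrite ltnNge; apply/negP => /(up_log_min (isT : 1 < 2)); rewrite leqNgt lt_i.
Qed.

Lemma modn_pow2S v i : v %% 2 ^ i.+1 = v %% 2 ^ i + odd (v %/ 2 ^ i) * 2 ^ i.
Proof.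
rewrite {1}(divn_eq v (2 ^ i)) -[v %/ 2 ^ i in LHS](odd_double_half).
rewrite mulnDl -mul2n -mulnA (mulnC 2) -mulnA (mulnC _ 2) -expnS -addnA addnCA.
rewrite modnMDl modn_small 1?addnC // expnS.
have := ltn_pmod v (expn_gt0 2 i : 0 < _); have := leq_b1 (odd (v %/ 2 ^ i)).
case: odd; rewrite ?mul1n ?mul0n; lia.
Qed.

Section Ram.
Variables (B beta : nat).
Hypotheses (B4 : 4 <= B) (B_beta : bitlen B <= beta).
Variable ok : seq bool -> Prop.
Notation wp := (wp ok).

Lemma wp_assign_ram x e rs A ib o tau (Q : _ -> _ -> _ -> _ -> Prop) :
  bounded B (ram rs A) e ->
  Q (ram (set_nth 0 rs x (eval (ram rs A) e)) A) ib o (tau + (expr_cap beta e + 2 * beta)) ->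
  wp (Assign x e) (ram rs A) ib o tau Q.
Proof. by rewrite -set_reg_ram; apply: (wp_assign B4 B_beta). Qed.

Lemma wp_recv_ram x (b : bool) rs A ib o tau (Q : _ -> _ -> _ -> _ -> Prop) : ok o ->
  Q (ram (set_nth 0 rs x b) A) ib o (tau + 1) -> wp (Recv x) (ram rs A) (b :: ib) o tau Q.
Proof. by rewrite -set_reg_ram; apply: wp_recv. Qed.

Lemma up_log_beta x : x <= B -> up_log 2 x <= beta.
Proof.
move=> le_xB; apply: leq_trans (leq_up_log 2 le_xB) _.
by apply: leq_trans B_beta; rewrite up_log_trunc_log // ?ltnS ?leq_trunc_log; lia.
Qed.

End Ram.

Ltac side := rewrite /=; repeat split; lia.
Ltac asg := eapply wp_assign_ram; [|eassumption| |]; [eassumption|side|rewrite /=].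
Ltac sq := apply: wp_seq.

(** * Correctness and cost of the basic loops *)

Section Loops.
Variables (B beta : nat).
Hypotheses (B4 : 4 <= B) (B_beta : bitlen B <= beta).
Variable ok : seq bool -> Prop.
Notation wp := (wp ok).

Let beta0 : 0 < beta. Proof. exact: beta_gt0 B_beta. Qed.
Let beta2 : beta <= beta * beta. Proof. by rewrite leq_pmulr. Qed.

Lemma wp_power n k l u t bd rest A ib o tau (Q : _ -> _ -> _ -> _ -> Prop) :
  bd + bd <= B ->
  (forall tau', tau' <= tau + 30 * (beta * beta) ->
    Q (ram [:: n, k, l, 2 ^ up_log 2 bd, t, bd & rest] A) ib o tau') ->
  wp power_loop (ram [:: n, k, l, u, t, bd & rest] A) ib o tau Q.
Proof.
move=> le_bd post; rewrite /power_loop; sq; asg.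
have le_w : up_log 2 bd <= beta by apply: (up_log_beta B4 B_beta); lia.
apply: (wp_while B4 B_beta (I := fun i s' ib' o' =>
  [/\ s' = ram [:: n, k, l, 2 ^ i, t, bd & rest] A, ib' = ib & o' = o])
  (n := up_log 2 bd) (K := 10 * beta)) => //.
- move=> i s_ ib_ o_ le_i [-> _ _] /=; rewrite -up_log_lt; split; last by case: ltnP.
  (* The last doubling starts below [bd]; round 0 is apart because [bd] may be 0. *)
  suff : 2 ^ i < bd + bd \/ i = 0 by case=> [?|->]; side.
  case: i le_i => [|i]; first by right.
  by rewrite -up_log_lt expnS; left; lia.
- move=> i _ _ _ tau' lt_i [-> -> ->]; have := lt_i; rewrite -up_log_lt => lt2.
  asg; split; last by rewrite /expr_cap /=; lia.
  by split=> //; rewrite addnn -mul2n -expnS.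
move=> _ _ _ tau' [-> -> ->] le_tau; apply: post.
apply: leq_trans le_tau _; rewrite /expr_cap /=.
have := leq_mul le_w (leqnn beta); lia.
Qed.

Lemma wp_send_loop n k l u t w rest A ib o tau (Q : _ -> _ -> _ -> _ -> Prop) :
  2 ^ w + 2 ^ w <= B -> t <= B ->
  (forall tau' t', tau' <= tau + 50 * (beta * beta) ->
    Q (ram [:: n, k, l, 2 ^ w, t', 2 ^ w & rest] A) ib (o ++ bits w t) tau') ->
  wp send_loop (ram [:: n, k, l, u, t, 2 ^ w & rest] A) ib o tau Q.
Proof.
move=> le_w le_t post; rewrite /send_loop; sq; asg.
have w_beta : w <= beta by rewrite -(up_expnK w (isT : 1 < 2)); apply: (up_log_beta B4 B_beta); lia.
apply: (wp_while B4 B_beta (I := fun i s' ib' o' =>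
  [/\ s' = ram [:: n, k, l, 2 ^ i, t %/ 2 ^ i, 2 ^ w & rest] A, ib' = ib & o' = o ++ bits i t])
  (n := w) (K := 30 * beta)).
- move=> i s_ ib_ o_ le_i [-> _ _] /=; rewrite ltn_exp2l //; split; last by case: ltnP.
  have : 2 ^ i <= 2 ^ w by rewrite leq_exp2l.
  by side.
- move=> i s_ ib_ o_ tau' lt_i [-> -> ->].
  have lt2 : 2 ^ i < 2 ^ w by rewrite ltn_exp2l.
  have le_ti : t %/ 2 ^ i <= B by apply: leq_trans (leq_div _ _) le_t.
  sq; apply: (wp_send B4 B_beta); first by side.
  sq; asg; asg; split; last by rewrite /expr_cap /=; lia.
  split; first by rewrite addnn -mul2n -expnS -divnMA -expnSr.
    by [].
  by rewrite /bits mkseqS -rcons_cat modn2 eqb0 negbK.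
- by rewrite expn0 divn1 cats0.
move=> s_ ib_ o_ tau' [-> -> ->] le_tau; apply: post.
apply: leq_trans le_tau _; rewrite /expr_cap /=.
have := leq_mul w_beta (leqnn beta); lia.
Qed.

Lemma wp_recv_loop n k l u t v w b rest A ib o tau (Q : _ -> _ -> _ -> _ -> Prop) :
  2 ^ w + 2 ^ w <= B -> v < 2 ^ w -> ok o ->
  (forall tau' b', tau' <= tau + 50 * (beta * beta) ->
    Q (ram [:: n, k, l, 2 ^ w, v, 2 ^ w, b' & rest] A) ib o tau') ->
  wp recv_loop (ram [:: n, k, l, u, t, 2 ^ w, b & rest] A) (bits w v ++ ib) o tau Q.
Proof.
move=> le_w lt_v oko post; rewrite /recv_loop; sq; asg; sq; asg.
have w_beta : w <= beta by rewrite -(up_expnK w (isT : 1 < 2)); apply: (up_log_beta B4 B_beta); lia.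
apply: (wp_while B4 B_beta (I := fun i s' ib' o' => exists b',
  [/\ s' = ram [:: n, k, l, 2 ^ i, v %% 2 ^ i, 2 ^ w, b' & rest] A,
     ib' = map (fun j => odd (v %/ 2 ^ j)) (iota i (w - i)) ++ ib & o' = o])
  (n := w) (K := 30 * beta)).
- move=> i s_ ib_ o_ le_i [b' [-> _ _]] /=; rewrite ltn_exp2l //; split; last by case: ltnP.
  have : 2 ^ i <= 2 ^ w by rewrite leq_exp2l.
  by side.
- move=> i s_ ib_ o_ tau' lt_i [b' [-> -> ->]].
  have lt2 : 2 ^ i < 2 ^ w by rewrite ltn_exp2l.
  have lt_vi : v %% 2 ^ i < 2 ^ i by rewrite ltn_mod expn_gt0.
  have -> : w - i = (w - i.+1).+1 by lia.
  rewrite /=; sq; apply: wp_recv_ram => //=.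
  have le_b : (odd (v %/ 2 ^ i) : nat) <= B by case: odd => /=; lia.
  sq; apply: (wp_if B4 B_beta) => //=.
  have [od|ev] := boolP (odd (v %/ 2 ^ i)); rewrite /=.
    asg; asg; split; last by rewrite /expr_cap /=; lia.
    exists 1; split=> //; rewrite addnn -mul2n -expnS modn_pow2S od mul1n //.
  apply: wp_skip; asg; split; last by rewrite /expr_cap /=; lia.
  exists 0; split=> //; rewrite addnn -mul2n -expnS modn_pow2S (negPf ev) mul0n addn0 //.
- by exists b; rewrite expn0 modn1 subn0.
move=> s_ ib_ o_ tau' [b' [-> -> ->]] le_tau; rewrite subnn modn_small //; apply: post.
apply: leq_trans le_tau _; rewrite /expr_cap /=.
have := leq_mul w_beta (leqnn beta); lia.
Qed.

Lemma wp_residue_loop n k l u t bd b p rest A ib o tau (Q : _ -> _ -> _ -> _ -> Prop) :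
  (forall i, A 0 i <= 1) -> 0 < bd -> bd + bd <= B -> p + n <= B -> n <= beta ->
  (forall tau', tau' <= tau + 70 * (beta * beta) ->
    Q (ram [:: n, k, l, n, string_value (A 0) p n %% bd, bd, b, p + n & rest] A) ib o tau') ->
  wp residue_loop (ram [:: n, k, l, u, t, bd, b, p & rest] A) ib o tau Q.
Proof.
move=> A01 bd0 le_bd le_p n_beta post; rewrite /residue_loop; sq; asg; sq; asg.
apply: (wp_while B4 B_beta (I := fun i s' ib' o' =>
  [/\ s' = ram [:: n, k, l, i, string_value (A 0) p i %% bd, bd, b, p + i & rest] A,
     ib' = ib & o' = o]) (n := n) (K := 50 * beta)).
- move=> i s_ ib_ o_ le_i [-> _ _] /=; split; last by case: ltnP.
  by side.
- move=> i s_ ib_ o_ tau' lt_i [-> -> ->].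
  have A1 := A01 (p + i); set r := _ %% bd.
  have lt_r : r < bd by rewrite ltn_mod.
  sq; asg; set x := r + r + _; have lt_x : x < bd + bd by rewrite /x; lia.
  have Ex : string_value (A 0) p i.+1 %% bd = x %% bd.
    by rewrite /= /x /r -(modnDml _ (A 0 (p + i))) -(modnDm (string_value _ _ _) (string_value _ _ _)) modnDml.
  sq; apply: (wp_if B4 B_beta) => /=; first by side.
  have [x_lt|x_ge] := ltnP x bd; rewrite /=.
    apply: wp_skip; sq; asg; asg; split; last by rewrite /expr_cap /=; lia.
    by split=> //; rewrite -[_ + _ + A 0 _]/(string_value (A 0) p i.+1) Ex modn_small // !addn1 addnS.
  asg; sq; asg; asg; split; last by rewrite /expr_cap /=; lia.
  split=> //; rewrite -[_ + _ + A 0 _]/(string_value (A 0) p i.+1) Ex -(subnK x_ge).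
  by rewrite modnDr modn_small ?addnK ?addn1 ?addnS //; lia.
- by rewrite mod0n addn0.
move=> s_ ib_ o_ tau' [-> -> ->] le_tau; apply: post.
apply: leq_trans le_tau _; rewrite /expr_cap /=.
have := leq_mul n_beta (leqnn beta); lia.
Qed.

Lemma wp_copy_loop n k l u t bd b p q rest A ib o tau (Q : _ -> _ -> _ -> _ -> Prop) :
  (forall i, A 0 i <= 1) -> p + n <= B -> q + n <= B -> n <= beta ->
  (forall tau' A', tau' <= tau + 70 * (beta * beta) ->
    (forall a, a != 1 -> A' a = A a) ->
    (forall i, A' 1 i = if q <= i < q + n then A 0 (p + (i - q)) else A 1 i) ->
    Q (ram [:: n, k, l, n, t, bd, b, p + n, q + n & rest] A') ib o tau') ->
  wp copy_loop (ram [:: n, k, l, u, t, bd, b, p, q & rest] A) ib o tau Q.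
Proof.
move=> A01 le_p le_q n_beta post; rewrite /copy_loop; sq; asg.
apply: (wp_while B4 B_beta (I := fun i s' ib' o' => exists A',
  [/\ s' = ram [:: n, k, l, i, t, bd, b, p + i, q + i & rest] A',
     ib' = ib, o' = o, (forall a, a != 1 -> A' a = A a) &
    (forall j, A' 1 j = if q <= j < q + i then A 0 (p + (j - q)) else A 1 j)])
  (n := n) (K := 50 * beta)).
- move=> i s_ ib_ o_ le_i [A' [-> _ _ _ _]] /=; split; last by case: ltnP.
  by side.
- move=> i s_ ib_ o_ tau' lt_i [A' [-> -> -> eqA' eqA1]].
  have A1 : A' 0 (p + i) <= 1 by rewrite eqA'.
  sq; apply: (wp_put B4 B_beta); [by side|by side|rewrite set_arr_ram /=].
  sq; asg; sq; asg; asg; split; last by rewrite /expr_cap /=; lia.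
  eexists; rewrite !addn1 -!addnS; split; [by []|by []|by []| |].
    by move=> a a1; rewrite -eqA' //; apply/funext => j; rewrite /upd (negPf a1).
  move=> j; rewrite /upd eqxx eqA1 eqA' //=; case: eqP => [->|ne]; last first.
    by have -> : (q <= j < q + i.+1) = (q <= j < q + i) by lia.
  by rewrite leq_addr ltn_add2l ltnSn addKn.
- exists A; rewrite !addn0; split=> // j; case: ifP => //; lia.
move=> s_ ib_ o_ tau' [A' [-> -> -> eqA eqA1]] le_tau; apply: post => //.
apply: leq_trans le_tau _; rewrite /expr_cap /=.
have := leq_mul n_beta (leqnn beta); lia.
Qed.

End Loops.

(** * Exhaustive search for the least separating parameter *)

Definition search_loop (mu : nat) (body : com) : com :=
  Seq (Assign 15 (Cst 0))
  (Seq (Assign 16 (Cst 0))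
    (While (Bin Eq (Reg 16) (Cst 0))
      (Seq (Assign 15 (Bin Add (Reg 15) (Cst 1)))
      (Seq (Assign 16 (Cst 1))
      (Seq (Assign 7 (Cst 0))
      (Seq (Assign 9 (Cst 0))
        (While (Bin Lt (Reg 9) (Reg 1))
          (Seq body
          (Seq (If (Bin Eq (Get mu (Reg 4)) (Reg 15)) (Assign 16 (Cst 0)) Skip)
          (Seq (Put mu (Reg 4) (Reg 15))
               (Assign 9 (Bin Add (Reg 9) (Cst 1))))))))))))).

Section Search.
Variables (B beta : nat).
Hypotheses (B4 : 4 <= B) (B_beta : bitlen B <= beta).
Variable ok : seq bool -> Prop.
Notation wp := (wp ok).

Let beta0 : 0 < beta. Proof. exact: beta_gt0 B_beta. Qed.
Let beta2 : beta <= beta * beta. Proof. by rewrite leq_pmulr. Qed.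

Variables (mu : nat) (body : com) (key : nat -> nat -> nat).
(** What [body] maintains once [i] keys of round [g] are done, with input address [ptr]. It must
    survive the marks written to array [mu] and the passage to the next round. *)
Variable J : nat -> nat -> nat -> (nat -> nat -> nat) -> Prop.
Variables (G K : nat) (n k l op N S Q m a : nat).
Let regs u t bd b ptr i g fnd := [:: n; k; l; u; t; bd; b; ptr; op; i; N; S; Q; m; a; g; fnd].

Hypothesis k0 : 0 < k.
Hypothesis k_le : k < B.
Hypothesis G0 : 0 < G.
Hypothesis G_le : G <= B.
Hypothesis G_uniq : uniq (mkseq (key G) k).
Hypothesis G_min : forall g, 0 < g < G -> ~~ uniq (mkseq (key g) k).
Hypothesis key_le : forall g i, 0 < g <= G -> i < k -> key g i <= B.
Hypothesis J_upd : forall g i ptr A j v, J g i ptr A -> J g i ptr (upd A mu j v).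
Hypothesis J_next : forall g ptr A, J g k ptr A -> J g.+1 0 0 A.
Hypothesis wp_body : forall g i u t bd b ptr fnd A ib o tau,
  0 < g <= G -> i < k -> J g i ptr A ->
  wp body (ram (regs u t bd b ptr i g fnd) A) ib o tau (fun s' ib' o' tau' =>
    [/\ ib' = ib, o' = o, tau' <= tau + K * (beta * beta) &
      exists u' bd' b' ptr' A',
      [/\ s' = ram (regs u' (key g i) bd' b' ptr' i g fnd) A',
          J g i.+1 ptr' A' & A' mu = A mu]]).

(* [A mu x] is the last round in which the key [x] was seen. *)
Let marked g i (A : nat -> nat -> nat) : Prop := forall x,
  A mu x <= g /\ (A mu x == g) = (x \in mkseq (key g) i).

Lemma wp_search u t bd b ptr i g fnd A ib o tau (R : _ -> _ -> _ -> _ -> Prop) :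
  (forall x, A mu x = 0) -> J 1 0 0 A ->
  (forall tau' u' t' bd' b' ptr' i' A',
    tau' <= tau + G * k * ((K + 100) * (beta * beta)) -> J G k ptr' A' ->
    R (ram (regs u' t' bd' b' ptr' i' G 1) A') ib o tau') ->
  wp (search_loop mu body) (ram (regs u t bd b ptr i g fnd) A) ib o tau R.
Proof.
have [F EF] : exists F, forall g i, F g i = uniq (mkseq (key g) i).
  by exists (fun g i => uniq (mkseq (key g) i)).
move=> A0 J0 post; rewrite /search_loop /regs; sq; asg; sq; asg.
pose KK := k * ((K + 50) * (beta * beta)) + 30 * beta.
(* The conjunct [0 < g] accounts for register 16 being 0 before the first round, where the invariant
   already has the form needed to enter round 1. *)
apply: (wp_while B4 B_beta (n := G) (K := KK) (I := fun g s' ib' o' =>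
  exists u t bd b ptr i A, [/\ s' = ram (regs u t bd b ptr i g ((0 < g) && F g k)) A,
   ib' = ib, o' = o, (forall x, A mu x <= g) & if g is 0 then J 1 0 0 A else J g k ptr A])).
- move=> {A0 J0 u t bd b ptr A i g}g s_ ib_ o_ le_g [u [t [bd [b [ptr [i [A [-> _ _ _ _]]]]]]]] /=.
  split; first by repeat split; case: (_ && _); lia.
  have -> (c : bool) : (((c : nat) == 0 : nat) != 0) = ~~ c by case: c.
  rewrite negb_and -leqNgt leqn0; have [->|g0] := posnP g; first by rewrite G0.
  have [->|g_lt] : g = G \/ g < G by lia.
    by rewrite EF G_uniq /= ltnn.
  by rewrite g_lt EF G_min ?g0.
- move=> {A0 J0 u t bd b ptr A i g}g s_ ib_ o_ tau' lt_g [u [t [bd [b [ptr [i [A [-> -> -> Amu HJ]]]]]]]].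
  rewrite /regs; sq; asg; sq; asg; sq; asg; sq; asg; rewrite addn1.
  apply: (wp_while B4 B_beta (n := k) (K := K * (beta * beta) + 45 * beta) (I := fun i s' ib' o' =>
    exists u t bd b ptr A, [/\ s' = ram (regs u t bd b ptr i g.+1 (F g.+1 i)) A,
    ib' = ib, o' = o, marked g.+1 i A & J g.+1 i ptr A])).
  + move=> {}i {}s_ {}ib_ {}o_ le_i [u' [t' [bd' [b' [ptr' [A' [-> _ _ _ _]]]]]]] /=.
    by split; [side | case: ltnP].
  + move=> {}i {}s_ {}ib_ {}o_ {}tau' lt_i [u' [t' [bd' [b' [ptr' [A' [-> -> -> mk JA]]]]]]].
    sq; apply: wp_weaken (wp_body _ _ _ _ _ _ _ _ _ lt_i JA) _; first by rewrite ltnS leq0n.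
    move=> {}s_ {}ib_ {}o_ tau2 [-> -> le_tau2 [u2 [bd2 [b2 [ptr2 [A2 [-> JA2 EA2]]]]]]].
    have key_leB : key g.+1 i <= B by apply: key_le => //; lia.
    have [le_mk eq_mk] := mk (key g.+1 i); have A2_le : A2 mu (key g.+1 i) <= B by rewrite EA2; lia.
    have JA3 := J_upd (key g.+1 i) g.+1 JA2.
    have mk3 : marked g.+1 i.+1 (upd A2 mu (key g.+1 i) g.+1).
      move=> x; rewrite /upd eqxx /= mkseqS mem_rcons inE; case: eqP => [->|ne] /=.
        by rewrite leqnn eqxx.
      by rewrite EA2; apply: mk.
    rewrite /regs; sq; apply: (wp_if B4 B_beta) => /=; first by side.
    rewrite EA2 eq_mk.
    have un : F g.+1 i.+1 = (key g.+1 i \notin mkseq (key g.+1) i) && F g.+1 i.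
      by rewrite !EF mkseqS rcons_uniq.
    have [dup|nodup] := boolP (key g.+1 i \in mkseq (key g.+1) i); rewrite /=.
      asg; sq; apply: (wp_put B4 B_beta); [by side|by side|rewrite set_arr_ram /=].
      asg; split; last by rewrite /expr_cap /=; lia.
      by eexists _, _, _, _, _, _; rewrite un dup /= addn1; split.
    apply: wp_skip; sq; apply: (wp_put B4 B_beta); [by side|by side|rewrite set_arr_ram /=].
    asg; split; last by rewrite /expr_cap /=; lia.
    by eexists _, _, _, _, _, _; rewrite un nodup /= addn1; split.
  + exists u, t, bd, b, 0, A; split=> //; rewrite ?EF //.
      by move=> x; have := Amu x; rewrite /= in_nil; split; [lia | apply/negbTE; lia].
    by case: g HJ {lt_g Amu} => // g; apply: J_next.
  move=> {}s_ {}ib_ {}o_ tau2 [u' [t' [bd' [b' [ptr' [A' [-> -> -> mk JA]]]]]]] le_tau.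
  split; last first.
    apply: leq_trans le_tau _; rewrite /KK /expr_cap /=.
    have le1 := leq_mul (leqnn k) beta2; lia.
  by exists u', t', bd', b', ptr', k, A'; split=> // x; case: (mk x).
- by exists u, t, bd, b, ptr, i, A; split=> // x; rewrite A0.
move=> s_ ib_ o_ tau' [u' [t' [bd' [b' [ptr' [i' [A' [-> -> -> _ HJ]]]]]]]] le_tau.
rewrite G0 EF G_uniq; apply: post; last by case: (G) G0 HJ.
apply: leq_trans le_tau _; rewrite /KK /expr_cap /=.
have GK : 0 < G * k by rewrite muln_gt0 G0.
have l1 := leq_mul (leqnn (G * k)) beta2; have l2 := leq_mul GK beta2.
have l3 : G * beta <= G * k * beta by rewrite leq_mul2r leq_pmulr ?orbT.
lia.
Qed.

End Search.

(** * The programs of Alice and Bob *)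

(** Both participants derive [N], [N / Q] and [Q] from [n] and [k], so these are never
    transmitted. *)
Definition setup : com :=
  Seq (Assign 5 (Bin Mul (Bin Mul (Cst 2) (Reg 1)) (Reg 1)))
  (Seq power_loop
  (Seq (Assign 11 (Reg 3))
  (Seq (Assign 5 (Bin Add (Bin Mul (Reg 5) (Reg 0)) (Cst 4)))
  (Seq power_loop
  (Seq (Assign 10 (Reg 3))
       (Assign 12 (Bin Div (Reg 10) (Reg 11)))))))).

Definition hash_expr (g : nat) (e : expr) : expr :=
  Bin Div (Bin Mod (Bin Mul (Bin Sub (Bin Add (Reg g) (Reg g)) (Cst 1)) e) (Reg 10)) (Reg 12).

(** Register 7 is never reset: [residue_loop] advances it by [n], to the start of the next
    string. *)
Definition alice_prog : com :=
  Seq setup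
  (Seq (Assign 5 (Reg 10))
  (Seq recv_loop
  (Seq (Assign 13 (Reg 4))
  (Seq recv_loop
  (Seq (Assign 14 (Reg 4))
  (While (Bin Lt (Reg 9) (Reg 2))
    (Seq (Assign 5 (Reg 13))
    (Seq residue_loop
    (Seq (Assign 4 (hash_expr 14 (Reg 4)))
    (Seq (Assign 5 (Reg 11))
    (Seq send_loop
         (Assign 9 (Bin Add (Reg 9) (Cst 1)))))))))))))).

(** Storing the residues spares the second search from reading the strings again. *)
Definition residue_body : com :=
  Seq (Assign 5 (Reg 15)) (Seq residue_loop (Put 3 (Reg 9) (Reg 4))).

(** Builds the inverse table in array 4. Entries left by failed rounds are harmless: the last round
    overwrites every cell that will be looked up. *)
Definition hash_body : com :=
  Seq (Assign 4 (hash_expr 15 (Get 3 (Reg 9)))) (Put 4 (Reg 4) (Reg 9)).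

Definition bob_prog : com :=
  Seq setup
  (Seq (search_loop 2 residue_body)
  (Seq (Assign 4 (Reg 15))
  (Seq (Assign 5 (Reg 10))
  (Seq send_loop
  (Seq (search_loop 5 hash_body)
  (Seq (Assign 4 (Reg 15))
  (Seq (Assign 5 (Reg 10))
  (Seq send_loop
  (Seq (Assign 9 (Cst 0))
  (Seq (Assign 5 (Reg 11))
  (While (Bin Lt (Reg 9) (Reg 2))
    (Seq recv_loop
    (Seq (Assign 7 (Bin Mul (Get 4 (Reg 4)) (Reg 0)))
    (Seq copy_loop
         (Assign 9 (Bin Add (Reg 9) (Cst 1))))))))))))))))).

(** * Specifications of the two programs *)

Section Programs.
Variables (n k l : nat).
Hypotheses (n0 : 0 < n) (k0 : 0 < k) (le_lk : l <= k).
(** [N = 2 ^ w >= M] exceeds the bound [n * k ^ 2 + 2] on the modulus, and [2 ^ s = N / Q] is the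
    range of the hash. [B = N ^ 2] leaves room for the product of a multiplier and a residue. *)
Variables (M w s B : nat).
Hypotheses (EM : M = 2 * k * k * n + 4) (Ew : w = up_log 2 M) (Es : s = up_log 2 (2 * k * k)).
Hypothesis (EB : B = 2 ^ w * 2 ^ w).
Variable beta : nat.
Hypotheses (B_beta : bitlen B <= beta) (n_beta : n <= beta).

Let le_M : M <= 2 ^ w. Proof. by rewrite Ew up_logP. Qed.

Let kk_M : 2 * k * k <= M.
Proof. by rewrite EM (leq_trans _ (leq_addr _ _)) // leq_pmulr. Qed.

Let kn_M : k * n <= M.
Proof.
rewrite EM (leq_trans _ (leq_addr _ _)) // leq_mul2r; apply/orP; right.
by rewrite leq_pmull // muln_gt0.
Qed.

Let le_sw : s <= w. Proof. by rewrite Es Ew leq_up_log. Qed.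

Let B4 : 4 <= B.
Proof. by have := leq_mul le_M le_M; rewrite -EB EM; lia. Qed.

Let NB : 4 * 2 ^ w <= B.
Proof. by rewrite EB leq_mul2r; apply/orP; right; apply: leq_trans le_M; rewrite EM leq_addl. Qed.

Let le_S : 2 ^ s <= 2 ^ w. Proof. by rewrite leq_exp2l. Qed.

Let beta0 : 0 < beta. Proof. exact: beta_gt0 B_beta. Qed.
Let beta2 : beta <= beta * beta. Proof. by rewrite leq_pmulr. Qed.

Let k_M : k <= M. Proof. by apply: leq_trans kn_M; rewrite leq_pmulr. Qed.
Let n_M : n <= M. Proof. by apply: leq_trans kn_M; rewrite leq_pmull. Qed.
Let M4 : 4 <= M. Proof. by rewrite EM leq_addl. Qed.

Lemma wp_setup ok A ib o tau (Q : _ -> _ -> _ -> _ -> Prop) :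
  (forall tau', tau' <= tau + 150 * (beta * beta) ->
    Q (ram [:: n; k; l; 2 ^ w; 0; M; 0; 0; 0; 0; 2 ^ w; 2 ^ s; 2 ^ (w - s); 0; 0; 0; 0] A) ib o tau') ->
  wp ok setup (ram [:: n; k; l; 0; 0; 0; 0; 0; 0; 0; 0; 0; 0; 0; 0; 0; 0] A) ib o tau Q.
Proof.
have le_2k : 2 * k <= 2 * k * k by rewrite leq_pmulr.
have Msplit : 2 * k * k * n <= M by rewrite EM leq_addr.
move=> post; rewrite /setup; sq; asg; sq; apply: (wp_power B4 B_beta); first lia.
move=> tau1 le1; rewrite -Es; sq; asg; sq; asg; sq; apply: (wp_power B4 B_beta); first by rewrite -EM; lia.
move=> tau2 le2; rewrite -EM -Ew; sq; asg; asg.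
rewrite -expnB //; apply: post.
move: le1 le2; rewrite /expr_cap /=; lia.
Qed.

Definition fingerprint m g (f : nat -> nat) i : nat :=
  odd_multiply_shift (2 ^ w) (2 ^ (w - s)) g (string_value f (i * n) n %% m).

Lemma fingerprint_lt m g f i : fingerprint m g f i < 2 ^ s.
Proof.
rewrite ltn_divLR ?expn_gt0 // -expnD subnKC //.
by rewrite ltn_mod expn_gt0.
Qed.

Variables (m g : nat).
Hypotheses (m0 : 0 < m) (m_lt : m < 2 ^ w) (g_le : g + g <= 2 ^ w).

Lemma wp_alice A tau (Q : _ -> _ -> _ -> _ -> Prop) : (forall i, A 0 i <= 1) ->
  (forall s' tau', tau' <= tau + l.+1 * (700 * (beta * beta)) ->
    Q s' [::] (flatten [seq bits s (fingerprint m g (A 0) i) | i <- iota 0 l]) tau') ->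
  wp (fun=> True) alice_prog (ram [:: n; k; l; 0; 0; 0; 0; 0; 0; 0; 0; 0; 0; 0; 0; 0; 0] A)
    (bits w m ++ bits w g ++ [::]) [::] tau Q.
Proof.
have [F EF] : exists F, forall i, F i = flatten [seq bits s (fingerprint m g (A 0) j) | j <- iota 0 i].
  by exists (fun i => flatten [seq bits s (fingerprint m g (A 0) j) | j <- iota 0 i]).
have FS i : F i ++ bits s (fingerprint m g (A 0) i) = F i.+1.
  by rewrite !EF -[i.+1]addn1 iotaD map_cat flatten_cat /= cats0.
rewrite -EF => A01 post; rewrite /alice_prog; sq; apply: wp_setup => tau1 le1.
have ln_M : l * n <= M by apply: leq_trans kn_M; rewrite leq_mul2r le_lk orbT.
have g_lt2 : g < 2 ^ w by lia.
sq; asg; sq; apply: (wp_recv_loop B4 B_beta) => //; first lia.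
move=> tau2 b2 le2; sq; asg; sq; apply: (wp_recv_loop B4 B_beta) => //; first lia.
move=> tau3 b3 le3; sq; asg.
apply: (wp_while B4 B_beta (n := l) (K := 300 * (beta * beta)) (I := fun i s' ib' o' =>
  exists u t bd b, [/\ s' = ram [:: n; k; l; u; t; bd; b; i * n; 0; i; 2 ^ w; 2 ^ s; 2 ^ (w - s); m; g; 0; 0] A,
   ib' = [::] & o' = F i])).
- move=> i s_ ib_ o_ le_i [u [t [bd [b [-> _ _]]]]] /=; split; last by case: ltnP.
  by side.
- move=> i s_ ib_ o_ tau' lt_i [u [t [bd [b [-> -> ->]]]]].
  have le_in : i * n + n <= M.
    by apply: leq_trans ln_M; rewrite addnC -mulSn leq_mul2r lt_i orbT.
  sq; asg; sq; apply: (wp_residue_loop B4 B_beta) => //; [lia|lia|].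
  move=> tau4 le4; set x := string_value _ _ _ %% m.
  have x_lt : x < m by rewrite ltn_mod.
  have le_prod : (g + g - 1) * x <= B by rewrite EB leq_mul //; lia.
  have le_Q : 2 ^ (w - s) <= 2 ^ w by rewrite leq_exp2l // leq_subr.
  sq; asg; sq; asg; sq; apply: (wp_send_loop B4 B_beta); first lia.
    have := fingerprint_lt m g (A 0) i; rewrite /fingerprint -/x /odd_multiply_shift; lia.
  move=> tau5 t5 le5; asg; split; last first.
    move: le4 le5; rewrite /expr_cap /=; lia.
  eexists _, _, _, _; rewrite mulSn (addnC n) !addn1; split; [by []|by []|].
  exact: FS.
- by eexists _, _, _, _; rewrite EF.
move=> s_ ib_ o_ tau' [u [t [bd [b [-> -> ->]]]]] le_tau; apply: post.
apply: leq_trans le_tau _; move: le1 le2 le3; rewrite /expr_cap /=.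
have := leq_mul (leqnn l) beta2; lia.
Qed.

Variables (f idx : nat -> nat).
Hypotheses (f1 : forall i, f i <= 1) (g0 : 0 < g) (idx_lt : forall i, i < l -> idx i < k).
Hypothesis m_uniq : uniq (mkseq (fun i => string_value f (i * n) n %% m) k).
Hypothesis m_min : forall m', 0 < m' < m ->
  ~~ uniq (mkseq (fun i => string_value f (i * n) n %% m') k).
Hypothesis g_uniq : uniq (mkseq (fingerprint m g f) k).
Hypothesis g_min : forall g', 0 < g' < g -> ~~ uniq (mkseq (fingerprint m g' f) k).

Let bob_out := bits w m ++ bits w g.

Let address i : i < k -> i * n + n <= M.
Proof.
move=> lt_ik; apply: leq_trans kn_M.
by rewrite addnC -mulSn leq_mul2r lt_ik orbT.
Qed.

(** [idx i] is the position in Bob's set of Alice's string [i], so the inbox can be written with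
    Bob's own fingerprints. *)
Lemma wp_bob A tau (Q : _ -> _ -> _ -> _ -> Prop) :
  A 0 = f -> (forall x, A 2 x = 0) -> (forall x, A 5 x = 0) ->
  (forall rs A' tau', tau' <= tau + 2 ^ w * k * (2000 * (beta * beta)) ->
    (forall i j, i < l -> j < n -> A' 1 (i * n + j) = f (idx i * n + j)) ->
    Q (ram rs A') [::] bob_out tau') ->
  wp (fun o => o = bob_out) bob_prog
    (ram [:: n; k; l; 0; 0; 0; 0; 0; 0; 0; 0; 0; 0; 0; 0; 0; 0] A)
    (flatten [seq bits s (fingerprint m g f (idx i)) | i <- iota 0 l]) [::] tau Q.
Proof.
move=> EA A2 A5 post.
have [F EF] : exists F, forall i, F i =
    flatten [seq bits s (fingerprint m g f (idx j)) | j <- iota i (l - i)].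
  by exists (fun i => flatten [seq bits s (fingerprint m g f (idx j)) | j <- iota i (l - i)]).
have FS i : i < l -> F i = bits s (fingerprint m g f (idx i)) ++ F i.+1.
  by rewrite !EF => lt_il; have -> : l - i = (l - i.+1).+1 by lia.
have Fl : F l = [::] by rewrite EF subnn.
have -> : flatten [seq bits s (fingerprint m g f (idx i)) | i <- iota 0 l] = F 0.
  by rewrite EF subn0.
have le_Q : 2 ^ (w - s) <= 2 ^ w by rewrite leq_exp2l // leq_subr.
rewrite /bob_prog; sq; apply: wp_setup => tau1 le1; sq.
(* Array 5 must still be blank when the second search starts. *)
pose J1 g' i ptr (A : nat -> nat -> nat) := [/\ ptr = i * n, A 0 = f, (forall x, A 5 x = 0)
  & forall j, j < i -> A 3 j = string_value f (j * n) n %% g'].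
apply: (wp_search B4 B_beta (J := J1) (G := m) (K := 120)
  (key := fun g' i => string_value f (i * n) n %% g')) => //; try lia.
- by move=> g' ptr A' [_ ? ? _]; split.
- move=> g' i u t bd b ptr fnd A' ib o tau' /andP[g'0 le_g'] lt_ik [-> EA' A'5 A'3].
  have le_in := address lt_ik.
  rewrite /residue_body; sq; asg; sq; apply: (wp_residue_loop B4 B_beta) => //.
  + by move=> x; rewrite EA'.
  + lia.
  + lia.
  move=> tau2 le2; rewrite EA'; set x := string_value _ _ _ %% g'.
  have x_lt : x < g' by rewrite ltn_mod.
  apply: (wp_put B4 B_beta); [by side|by side|rewrite set_arr_ram /=].
  split=> //; first by move: le2; rewrite /expr_cap /=; lia.
  eexists _, _, _, _, _; split; [by []| |by []].
  split=> //; first by rewrite mulSn addnC.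
  move=> j; rewrite /upd /= ltnS; case: eqP => [->//|ne] le_j.
  by apply: A'3; lia.
move=> tau2 u2 t2 bd2 b2 ptr2 i2 A3 le2 [_ EA3 A35 A33].
sq; asg; sq; asg; sq; apply: (wp_send_loop B4 B_beta); [lia|lia|].
move=> tau3 t3 le3; sq.
(* The inverse table is claimed correct only while the hash values are distinct; this becomes
   unconditional in the last round by [g_uniq]. *)
pose J2 g' i (ptr : nat) (A : nat -> nat -> nat) := [/\ A 0 = f,
  (forall j, j < k -> A 3 j = string_value f (j * n) n %% m)
  & uniq (mkseq (fingerprint m g' f) i) -> forall j, j < i -> A 4 (fingerprint m g' f j) = j].
apply: (wp_search B4 B_beta (J := J2) (G := g) (K := 120)
  (key := fun g' i => fingerprint m g' f i)) => //; try lia.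
- by move=> g' i _ _; have := fingerprint_lt m g' f i; lia.
- by move=> g' ptr A' [? ? _]; split.
- move=> g' i u t bd b ptr fnd A' ib o tau' /andP[g'0 le_g'] lt_ik [EA' A'3 A'4].
  have x_lt : A' 3 i < m by rewrite A'3 // ltn_mod.
  have le_prod : (g' + g' - 1) * A' 3 i <= B by rewrite EB leq_mul //; lia.
  have fp_lt := fingerprint_lt m g' f i.
  rewrite /hash_body; sq; asg.
  have -> : ((g' + g' - 1) * A' 3 i) %% 2 ^ w %/ 2 ^ (w - s) = fingerprint m g' f i.
    by rewrite A'3.
  apply: (wp_put B4 B_beta); [by side|by side|rewrite set_arr_ram /=].
  split=> //; first by rewrite /expr_cap /=; lia.
  eexists _, _, _, _, _; split; [by []| |by []].
  split=> //; rewrite mkseqS rcons_uniq => /andP[new un] j; rewrite /upd /= ltnS.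
  have [->|ne] := eqVneq j i; first by rewrite eqxx.
  move=> le_ji; have lt_ji : j < i by lia.
  case: eqP => [E|_]; last exact: A'4.
  by case/negP: new; rewrite -E map_f // mem_iota.
move=> tau4 u4 t4 bd4 b4 ptr4 i4 A4 le4 [EA4 _ /(_ g_uniq) A44].
sq; asg; sq; asg; sq; apply: (wp_send_loop B4 B_beta); [lia|lia|].
move=> tau5 t5 le5; sq; asg; sq; asg.
apply: (wp_while B4 B_beta (n := l) (K := 300 * (beta * beta)) (I := fun i s' ib' o' =>
  exists u t b ptr A', [/\ s' = ram [:: n; k; l; u; t; 2 ^ s; b; ptr; i * n; i; 2 ^ w; 2 ^ s; 2 ^ (w - s); 0; 0; g; 1] A',
   ib' = F i, o' = bob_out, (A' 0 = f /\ forall j, j < k -> A' 4 (fingerprint m g f j) = j)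
   & forall i' j, i' < i -> j < n -> A' 1 (i' * n + j) = f (idx i' * n + j)])).
- move=> i s_ ib_ o_ le_i [u [t [b [ptr [A' [-> _ _ _ _]]]]]] /=; split; last by case: ltnP.
  by side.
- move=> i s_ ib_ o_ tau' lt_i [u [t [b [ptr [A' [-> -> -> [EA' A'4] A'1]]]]]].
  have lt_idx := idx_lt lt_i; have le_p := address lt_idx.
  have le_q : i * n + n <= M by apply: address; lia.
  have fp_lt := fingerprint_lt m g f (idx i).
  have A'4i := A'4 _ lt_idx.
  rewrite FS //; sq; apply: (wp_recv_loop B4 B_beta) => //; first lia.
  move=> tau6 b6 le6; sq; asg; rewrite A'4i.
  sq; apply: (wp_copy_loop B4 B_beta) => //; [by move=> x; rewrite EA' | lia | lia |].
  move=> tau7 A'' le7 eqA eqA1; asg; split; last first.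
    by move: le6 le7; rewrite /expr_cap /=; lia.
  eexists _, _, _, _, _; split.
  + by rewrite mulSn (addnC n) !addn1.
  + by [].
  + by [].
  + by rewrite !eqA.
  move=> i' j lt_i' lt_j; rewrite eqA1 EA'; have [->|ne] := eqVneq i' i.
    by rewrite leq_addr ltn_add2l lt_j addKn.
  have lt2 : i' < i by lia.
  have lt3 : i' * n + j < i * n.
    by apply: (@leq_trans (i'.+1 * n)); rewrite ?leq_mul2r ?lt2 ?orbT // mulSn addnC ltn_add2r.
  by rewrite [i * n <= _]leqNgt lt3 /=; apply: A'1.
- by eexists _, _, _, _, _; split.
move=> s_ ib_ o_ tau' [u [t [b [ptr [A' [-> -> -> _ A'1]]]]]] le_tau.
rewrite Fl; apply: post => //; apply: leq_trans le_tau _.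
have l_le : l <= 2 ^ w * k by apply: leq_trans le_lk _; rewrite leq_pmull // expn_gt0.
have wk : 0 < 2 ^ w * k by rewrite muln_gt0 expn_gt0.
have m_le : m * k <= 2 ^ w * k by rewrite leq_mul2r ltnW ?orbT.
have gk_le : g * k <= 2 ^ w * k by rewrite leq_mul2r; apply/orP; right; lia.
have p1 := leq_mul l_le beta2; have p2 := leq_mul wk beta2.
have p3 := leq_mul m_le (leqnn (beta * beta)); have p4 := leq_mul gk_le (leqnn (beta * beta)).
have p5 := leq_mul l_le (leqnn (beta * beta)).
have p6 := leq_mul wk (leqnn (beta * beta)).
move: le1 le2 le3 le4 le5; rewrite /expr_cap /=.
lia.
Qed.

End Programs.

(** * Correctness and complexity *)

Lemma string_value_eq f f' p p' n : (forall j, j < n -> f (p + j) = f' (p' + j)) ->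
  string_value f p n = string_value f' p' n.
Proof.
elim: n => //= n IHn eqf; rewrite IHn ?eqf // => j lt_jn.
by rewrite eqf // ltnS ltnW.
Qed.

Lemma string_value_inj f f' p p' n : (forall i, f i <= 1) -> (forall i, f' i <= 1) ->
  string_value f p n = string_value f' p' n -> forall j, j < n -> f (p + j) = f' (p' + j).
Proof.
move=> f1 f'1; elim: n => //= n IHn eqv j; have := f1 (p + n); have := f'1 (p' + n).
move=> le1 le2; have [E1 E2] : string_value f p n = string_value f' p' n /\ f (p + n) = f' (p' + n).
  lia.
by rewrite ltnS leq_eqVlt => /orP[/eqP->|/IHn]; [ | apply].
Qed.

Lemma string_value_lt f p n : (forall i, f i <= 1) -> string_value f p n < 2 ^ n.
Proof. by move=> f1; elim: n => //= n IHn; have := f1 (p + n); rewrite expnS; lia. Qed.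

Lemma nth_flatten_uniform (T : Type) (x0 : T) n (ss : seq (seq T)) i j :
  (forall i, i < size ss -> size (nth [::] ss i) = n) -> j < n -> i < size ss ->
  nth x0 (flatten ss) (i * n + j) = nth x0 (nth [::] ss i) j.
Proof.
move=> + lt_j; elim: ss i => // y ss IHss [|i] sz /= lt_i; rewrite nth_cat (sz 0 isT).
  by rewrite mul0n add0n lt_j.
rewrite mulSn -addnA ltnNge leq_addr /= addKn; apply: IHss => // i' lt_i'.
exact: (sz i'.+1).
Qed.

Lemma nth_bits_of (m n : nat) (x : m.-tuple (n.-tuple bool)) (i : 'I_m) j : j < n ->
  nth false (bits_of x) (i * n + j) = nth false (tnth x i) j.
Proof.
move=> lt_j; rewrite /bits_of.
have nth_x (i' : 'I_m) : nth [::] (map val x) i' = tnth x i'.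
  by rewrite (nth_map (tnth x i')) ?size_tuple // -tnth_nth.
rewrite (@nth_flatten_uniform _ false n) ?nth_x // ?size_map ?size_tuple // => i' lt_i'.
by rewrite (nth_x (Ordinal lt_i')) size_tuple.
Qed.

(** Pads the input registers with the default 0 of [nth], giving a list with all 17 registers
    explicit. *)
Lemma ram_start n k l A :
  Store (nth 0 [:: n; k; l]) A = ram [:: n; k; l; 0; 0; 0; 0; 0; 0; 0; 0; 0; 0; 0; 0; 0; 0] A.
Proof.
rewrite /ram; congr Store; apply/funext => x.
rewrite -[[:: _, _, _, 0 & _]]/([:: n; k; l] ++ nseq 14 0) nth_cat nth_nseq.
by case: ltnP => // le; rewrite nth_default //; case: ifP.
Qed.

Lemma size_bits w v : size (bits w v) = w.
Proof. exact: size_mkseq. Qed.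

(** * Sizes of the modulus, the hash range and the machine words *)

Section Sizes.
Variables (n k : nat).
Hypotheses (n0 : 0 < n) (k0 : 0 < k).
Let M := 2 * k * k * n + 4.
Let w := up_log 2 M.
Let s := up_log 2 (2 * k * k).

(** Rounding up to a power of two less than doubles: [2 ^ w < 2 * M = 4 * (k ^ 2 * n) + 8], and
    [k ^ 2 * n >= 1]. *)
Lemma modulus_size : 2 ^ w <= 12 * (k ^ 2 * n).
Proof.
have kn : 0 < k ^ 2 * n by rewrite muln_gt0 expn_gt0 k0.
have M1 : 1 < M by rewrite /M addn4.
have := up_log_gtn (isT : 1 < 2) M1; rewrite -/w.
have -> : M = 2 * (k ^ 2 * n) + 4 by rewrite /M -mulnn; lia.
have : 0 < w by rewrite up_log_gt0.
case: w => // w' _ /=; rewrite (expnS 2).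
by move: (k ^ 2 * n) (2 ^ w') kn => X Y; clear; lia.
Qed.

Lemma hash_size : 2 ^ s <= 4 * k ^ 2.
Proof.
have kk : 0 < k ^ 2 by rewrite expn_gt0 k0.
have E : 2 * k * k = 2 * k ^ 2 by rewrite -mulnn mulnA.
have M1 : 1 < 2 * k * k by rewrite E; lia.
have := up_log_gtn (isT : 1 < 2) M1; rewrite -/s.
have : 0 < s by rewrite up_log_gt0.
rewrite E; case: s => // s' _ /=; rewrite (expnS 2).
by move: (k ^ 2) (2 ^ s') kk => X Y; clear; lia.
Qed.

(** Distinct strings force [k <= 2 ^ n], whence [w <= 4 + 3n] from [12 <= 2 ^ 4] and [n <= 2 ^ n];
    then [2w + 1 <= 9 + 6n <= 15n]. So all words have length [O(n)], whatever [k] is. *)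
Lemma bitlen_modulus : k <= 2 ^ n -> bitlen (2 ^ w * 2 ^ w) <= 15 * n.
Proof.
move=> le_k.
have w_le : 2 ^ w <= 2 ^ (4 + 3 * n).
  apply: leq_trans modulus_size _; rewrite expnD leq_mul // mulSn mulnC expnD.
  apply: leq_mul; first exact: ltnW (ltn_expl _ _).
  by rewrite mulnC expnM leq_exp2r.
rewrite leq_exp2l // in w_le.
rewrite -expnD /bitlen trunc_expnK //; lia.
Qed.

End Sizes.

Lemma least_uniq_mkseq (key : nat -> nat -> nat) k b :
  (exists2 g, 0 < g <= b & uniq (mkseq (key g) k)) ->
  exists g, [/\ 0 < g <= b, uniq (mkseq (key g) k) &
    forall g', 0 < g' < g -> ~~ uniq (mkseq (key g') k)].
Proof.
case=> g0 /andP[g0_gt0 g0_le] g0_uniq.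
have ex : exists g, (0 < g) && uniq (mkseq (key g) k) by exists g0; rewrite g0_gt0.
case: (ex_minnP ex) => g /andP[g_gt0 g_uniq] g_min.
exists g; split=> //; first by rewrite g_gt0 (leq_trans _ g0_le) // g_min // g0_gt0.
move=> g' /andP[g'0 lt_g']; apply/negP => g'_uniq.
by have := g_min g'; rewrite g'0 g'_uniq leqNgt lt_g' => /(_ isT).
Qed.

Definition input_bit (m n : nat) (x : m.-tuple (n.-tuple bool)) (i : nat) : nat :=
  nth false (bits_of x) i.

Lemma input_bit_le1 m n (x : m.-tuple (n.-tuple bool)) i : input_bit x i <= 1.
Proof. exact: leq_b1. Qed.

Lemma string_value_input_inj m n (x : m.-tuple (n.-tuple bool)) (i j : 'I_m) :
  string_value (input_bit x) (i * n) n = string_value (input_bit x) (j * n) n ->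
  tnth x i = tnth x j.
Proof.
move/(string_value_inj (input_bit_le1 x) (input_bit_le1 x)) => eqb; apply/val_inj.
apply: (@eq_from_nth _ false); rewrite !size_tuple // => a lt_a.
by have := eqb a lt_a; rewrite /input_bit !nth_bits_of //; do 2 case: nth.
Qed.

Lemma separating_keys n k (Y : k.-tuple (n.-tuple bool)) :
  let M := 2 * k * k * n + 4 in let w := up_log 2 M in let s := up_log 2 (2 * k * k) in
  let f := input_bit Y in 0 < n -> 0 < k -> uniq Y -> exists m g,
  [/\ [/\ 0 < m, m < 2 ^ w, 0 < g & g + g <= 2 ^ w],
      uniq (mkseq (fun i => string_value f (i * n) n %% m) k),
      forall m', 0 < m' < m -> ~~ uniq (mkseq (fun i => string_value f (i * n) n %% m') k),
      uniq (mkseq (fingerprint n w s m g f) k) &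
      forall g', 0 < g' < g -> ~~ uniq (mkseq (fingerprint n w s m g' f) k)].
Proof.
move=> M w s f n0 k0 Y_uniq; pose v := mkseq (fun i => string_value f (i * n) n) k.
have kn : 0 < k ^ 2 * n by rewrite muln_gt0 expn_gt0 k0.
have EM : M = 2 * (k ^ 2 * n) + 4 by rewrite /M -mulnn !mulnA.
have le_M : M <= 2 ^ w by apply: up_logP.
have v_uniq : uniq v.
  rewrite /v map_inj_in_uniq ?iota_uniq // => i j; rewrite !mem_iota /= !add0n => lt_i lt_j E.
  have /(_ (Ordinal lt_i) (Ordinal lt_j) E) := @string_value_input_inj _ _ Y.
  by rewrite !(tnth_nth (nseq_tuple n false)) => /eqP; rewrite nth_uniq ?size_tuple // => /eqP.
have [|m [/andP[m0 m_le] m_uniq m_min]] :=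
  @least_uniq_mkseq (fun m i => string_value f (i * n) n %% m) k (n * k ^ 2 + 2).
  have [|m] := @separating_modulus n v v_uniq.
    by move=> _ /mapP[i _ ->]; apply: string_value_lt; apply: input_bit_le1.
  by rewrite /v size_mkseq -map_comp => m_in m_un; exists m.
have m_lt : m < 2 ^ w.
  apply: leq_trans le_M; rewrite EM; move: m_le; rewrite (mulnC n); clear -kn; lia.
pose r := mkseq (fun i => string_value f (i * n) n %% m) k.
have w0 : 0 < w by rewrite up_log_gt0 /= EM; clear -kn; lia.
(* The multiplier lemma takes the modulus as [2 ^ w.-1.+1]; its bound [g <= 2 ^ w.-1] is what yields
   [g + g <= 2 ^ w]. *)
have Ew : w = w.-1.+1 by rewrite prednK.
have le_sw : s <= w.
  by rewrite leq_up_log // /M (leq_trans _ (leq_addr _ _)) // leq_pmulr.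
have [|g [/andP[g0 g_le] g_uniq g_min]] :=
  @least_uniq_mkseq (fun g => fingerprint n w s m g f) k (2 ^ w.-1).
  have := @separating_odd_multiplier w.-1 s r; rewrite -Ew => -[//||//||g g_in g_un].
  - by move=> _ /mapP[i _ ->]; apply: ltn_trans m_lt; rewrite ltn_mod.
  - by rewrite /r size_mkseq -mulnn mulnA up_logP.
  by exists g => //; rewrite -map_comp in g_un.
exists m, g; split=> //; split=> //.
by rewrite addnn -mul2n Ew expnS leq_mul2l.
Qed.

Lemma uniq_size_exp2 n k (Y : k.-tuple (n.-tuple bool)) : uniq Y -> k <= 2 ^ n.
Proof.
move=> Y_uniq; rewrite -card_bool -card_tuple -[k in k <= _](size_tuple Y).
by rewrite -(card_uniqP Y_uniq) max_card.
Qed.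

(** Here 2700 is [225 * 12], from [beta * beta = 225 * n ^ 2] and [modulus_size]; 2000 comes from
    [wp_bob]. The other constants are smaller. *)
Definition time_factor : nat := 2700 * 2000.

Section Correctness.
Variables (n k l : nat).
Hypotheses (n0 : 0 < n) (k0 : 0 < k) (l0 : 0 < l) (le_lk : l <= k).
Variables (X : l.-tuple (n.-tuple bool)) (Y : k.-tuple (n.-tuple bool)).
Hypotheses (Y_uniq : uniq Y) (sub_XY : {subset X <= Y}).
Let M := 2 * k * k * n + 4.
Let w := up_log 2 M.
Let s := up_log 2 (2 * k * k).

Let jrun t := iter t (joint_step no_coin no_coin)
  (start alice_prog n k l (bits_of X), start bob_prog n k l (bits_of Y)).

(** The output of each solo run is the inbox of the other, since equal strings have equal
    fingerprints; the results on joint runs then apply to the two. *)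
Lemma protocol_correct :
  [/\ forall t, sent (jrun t).1 + sent (jrun t).2 <= w + w + l * s,
      forall t, halted (jrun t).1 && halted (jrun t).2 ->
        sent (jrun t).1 + sent (jrun t).2 = w + w + l * s,
      forall t, halted (jrun t).2 -> answer n l (jrun t).2 = X,
      forall t, time (jrun t).1 <= time_factor * (l * n ^ 2) /\
                time (jrun t).2 <= time_factor * (k ^ 3 * n ^ 3) &
      exists t, halted (jrun t).1 && halted (jrun t).2].
Proof.
have [m [g [[m0 m_lt g0 g_le] m_uniq m_min g_uniq g_min]]] := separating_keys n0 k0 Y_uniq.
rewrite -/M -/w -/s in m_lt g_le g_uniq g_min.
pose fX := input_bit X; pose fY := input_bit Y.
pose idx i := index (nth (nseq_tuple n false) X i) Y.
have idx_in i : i < l -> nth (nseq_tuple n false) X i \in Y.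
  by move=> lt_i; apply: sub_XY; rewrite mem_nth ?size_tuple.
have idx_lt i : i < l -> idx i < k.
  by move=> /idx_in; rewrite -index_mem size_tuple.
have eq_bit i j : i < l -> j < n -> fY (idx i * n + j) = fX (i * n + j).
  move=> lt_i lt_j; rewrite /fY /fX /input_bit.
  rewrite (nth_bits_of X (Ordinal lt_i)) // (nth_bits_of Y (Ordinal (idx_lt i lt_i))) //.
  by rewrite !(tnth_nth (nseq_tuple n false)) /= nth_index // idx_in.
have eq_fp i : i < l -> fingerprint n w s m g fX i = fingerprint n w s m g fY (idx i).
  move=> lt_i; rewrite /fingerprint; congr (odd_multiply_shift _ _ _ (_ %% _)).
  by apply: string_value_eq => j lt_j; rewrite eq_bit.
pose inA := bits w m ++ bits w g.
pose inB := flatten [seq bits s (fingerprint n w s m g fY (idx i)) | i <- iota 0 l].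
have EinB : inB = flatten [seq bits s (fingerprint n w s m g fX i) | i <- iota 0 l].
  congr flatten; apply/eq_in_map => i; rewrite mem_iota add0n => /andP[_ lt_i].
  by rewrite eq_fp.
pose beta := 15 * n.
have B_beta : bitlen (2 ^ w * 2 ^ w) <= beta.
  by apply: bitlen_modulus => //; apply: uniq_size_exp2 Y_uniq.
have n_beta : n <= beta by rewrite leq_pmull.
pose arrays (f : nat -> nat) (a i : nat) := if a == 0 then f i else 0.
have [sA [ibA [outA [TA [runA [leTA EoutA EibA]]]]]] :
    wp (fun=> True) alice_prog
      (ram [:: n; k; l; 0; 0; 0; 0; 0; 0; 0; 0; 0; 0; 0; 0; 0; 0] (arrays fX))
      inA [::] 0 (fun _ ib o tau =>
      [/\ tau <= l.+1 * (700 * (beta * beta)), o = inB & ib = [::]]).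
  have := @wp_alice n k l n0 k0 le_lk M w s _ erefl erefl erefl erefl beta B_beta n_beta
    m g m0 m_lt g_le (arrays fX) 0.
  rewrite cats0 -/inA -EinB; apply.
    by move=> i; apply: input_bit_le1.
  by move=> s' tau' le; split.
have [sB [ibB [outB [TB [runB [leTB EoutB EibB ansB]]]]]] :
    wp (fun o => o = inA) bob_prog
      (ram [:: n; k; l; 0; 0; 0; 0; 0; 0; 0; 0; 0; 0; 0; 0; 0; 0] (arrays fY))
      inB [::] 0 (fun s' ib o tau =>
      [/\ tau <= 2 ^ w * k * (2000 * (beta * beta)), o = inA, ib = [::] &
        forall i j, i < l -> j < n -> arr s' 1 (i * n + j) = fY (idx i * n + j)]).
  apply: (@wp_bob n k l n0 k0 le_lk M w s _ erefl erefl erefl erefl beta B_beta n_beta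
    m g m0 m_lt g_le fY idx) => //; exact: input_bit_le1.
have [NA [tA [letA soloA]]] := runA [::] 0; have [NB [tB [letB soloB]]] := runB [::] 0.
(* A solo run begins in the true initial state with the whole incoming message delivered. *)
have startE c N (Z : N.-tuple (n.-tuple bool)) ib :
    Party [:: c] (ram [:: n; k; l; 0; 0; 0; 0; 0; 0; 0; 0; 0; 0; 0; 0; 0; 0] (arrays (input_bit Z))) ib 0 0 0
    = deliver (start c n k l (bits_of Z)) ib.
  by rewrite -ram_start.
rewrite /= !startE EoutA in soloA; rewrite /= !startE EoutB in soloB.
pose FA := Party [::] sA ibA 0 (size inB) tA; pose FB := Party [::] sB ibB 0 (size inA) tB.
have safe := @joint_run_safe _ _ _ FA FB _ _ _ _ erefl erefl soloA soloB.
have haltA := @joint_run_haltedA _ _ _ FA FB _ _ _ _ erefl erefl soloA soloB.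
have haltB := @joint_run_haltedB _ _ _ FA FB _ _ _ _ erefl erefl soloA soloB.
have halts := @joint_run_halts _ _ _ FA FB _ _ _ _ erefl erefl soloA soloB.
have szA : size inA = w + w by rewrite size_cat !size_bits.
have szB : size inB = l * s.
  rewrite -[l in RHS](size_iota 0) /inB; elim: (iota 0 l) => //= i r IHr.
  by rewrite size_cat size_bits IHr mulSn.
split=> //.
- by move=> t; have [_ _] := safe t; rewrite /= szA szB -/(jrun t); lia.
- move=> t /andP[/haltA[_ EA] /haltB[_ EB]]; move: EA EB; rewrite /= szA szB -/(jrun t); lia.
- move=> t /haltB[EB _]; rewrite /answer -/(jrun t) EB /=; apply/eq_from_tnth => i.
  rewrite tnth_mktuple; apply/eq_from_tnth => j; rewrite tnth_mktuple.
  rewrite ansB // eq_bit // /fX /input_bit nth_bits_of // (tnth_nth false (tnth X i)).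
  by case: nth.
move=> t; have [leA leB _ _] := safe t; rewrite -/(jrun t) /= in leA leB.
have beta2 : beta * beta = 225 * n ^ 2 by rewrite /beta -mulnn; lia.
split.
  apply: leq_trans leA _; apply: leq_trans letA _; apply: leq_trans leTA _.
  rewrite beta2 /time_factor.
  (* By [l0], Alice's setup is absorbed into the time for her [l] strings. *)
  have : l.+1 <= 2 * l by lia.
  move=> /leq_mul/(_ (leqnn (n ^ 2))); lia.
apply: leq_trans leB _; apply: leq_trans letB _; apply: leq_trans leTB _.
have := leq_mul (leq_mul (modulus_size n0 k0) (leqnn k)) (leqnn (n ^ 2)); rewrite -/M -/w.
rewrite beta2 /time_factor.
have -> : 12 * (k ^ 2 * n) * k * n ^ 2 = 12 * (k ^ 3 * n ^ 3) by rewrite !expnS !expn0; lia.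
lia.
Qed.

End Correctness.

(** * The logarithmic bound and the expected time *)

Import Order.TTheory GRing.Theory Num.Theory.
Local Open Scope ring_scope.

Lemma log2_ge (R : realType) (a x : nat) : (2 ^ a <= x)%N -> (a%:R : R) <= log2 x%:R.
Proof.
move=> le_ax; have x0 : (0 < x)%N by apply: leq_trans le_ax; rewrite expn_gt0.
have ln2 : 0 < ln 2 :> R by rewrite ln_gt0 // ltr1n.
rewrite /log2 ler_pdivlMr // mulr_natl -lnXn ?ltr0n // -natrX.
by rewrite ler_ln ?posrE ?ltr0n ?expn_gt0 // ler_nat.
Qed.

Lemma log2M (R : realType) (x y : nat) : (0 < x)%N -> (0 < y)%N ->
  log2 ((x * y)%N%:R : R) = log2 x%:R + log2 y%:R.
Proof. by move=> x0 y0; rewrite /log2 natrM lnM ?posrE ?ltr0n // mulrDl. Qed.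

Lemma log2_expn2 (R : realType) a : log2 ((2 ^ a)%N%:R : R) = a%:R.
Proof.
have ln2 : 0 < ln 2 :> R by rewrite ln_gt0 // ltr1n.
by rewrite /log2 natrX lnXn ?ltr0n // -[_ *+ a]mulr_natl mulfK // gt_eqF.
Qed.

(** With [w <= 4 + 2 log k + log n] and [s <= 2 + 2 log k], the sum [2w + l s] exceeds the main
    terms by at most [8 + 2l <= 10l]. *)
Lemma communication_bound (R : realType) n k l : (0 < n)%N -> (0 < k)%N -> (0 < l)%N ->
  let w := up_log 2 (2 * k * k * n + 4) in let s := up_log 2 (2 * k * k) in
  is_true (((w + w + l * s)%N%:R : R) <=
    2 * log2 n%:R + (2 * l + 4)%:R * log2 k%:R + (10 * l)%N%:R).
Proof.
move=> n0 k0 l0 w s.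
have w_le : (w%:R : R) <= 4 + 2 * log2 k%:R + log2 n%:R.
  have : (2 ^ w <= 2 ^ 4 * (k * k * n))%N.
    by apply: leq_trans (modulus_size n0 k0) _; rewrite mulnn leq_mul2r orbT.
  move/(log2_ge R); rewrite log2M ?muln_gt0 ?k0 ?n0 ?expn_gt0 // log2_expn2 !log2M ?muln_gt0 ?k0 //; lra.
have s_le : (s%:R : R) <= 2 + 2 * log2 k%:R.
  have : (2 ^ s <= 2 ^ 2 * (k * k))%N by rewrite mulnn; exact: (hash_size k0).
  move/(log2_ge R); rewrite log2M ?muln_gt0 ?k0 ?expn_gt0 // log2_expn2 log2M //; lra.
have l1 : (1 : R) <= l%:R by rewrite ler1n.
rewrite !natrD !natrM; nra.
Qed.

Theorem mainTheorem1 (R : realType) :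
  exists (alice bob : com) (c : nat),
    flip_free alice /\
    forall (n k l : nat), (0 < n)%N -> (0 < k)%N -> (0 < l)%N -> (l <= k)%N ->
    exists C : nat,
      (C%:R : R) <= 2 * log2 (n%:R : R) + (2 * l + 4)%:R * log2 (k%:R : R)
                    + (c * l)%:R /\
      forall (X : l.-tuple (n.-tuple bool)) (Y : k.-tuple (n.-tuple bool)),
        uniq Y -> {subset X <= Y} ->
        (* whatever the random bits: communication, correctness, Alice's time *)
        (exists m : nat, (m <= C)%N /\
           forall (coin : nat -> bool) (t : nat),
             (bits_sent alice bob X Y coin t <= m)%N /\
             (all_halted alice bob X Y coin t ->
              bits_sent alice bob X Y coin t = m)) /\
        (forall (coin : nat -> bool) (t : nat),
           halted (run alice bob X Y coin t).2 ->
           answer n l (run alice bob X Y coin t).2 = X) /\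
        (forall (coin : nat -> bool) (t : nat),
           (time (run alice bob X Y coin t).1 <= c * (l * n ^ 2))%N) /\
        (* over the random bits: termination and Bob's expected time *)
        (forall (d : measure_display) (T : measurableType d)
                (P : probability T R) (coin : nat -> T -> bool),
           fair_coins P coin ->
           {ae P, forall x, exists t,
              all_halted alice bob X Y (fun i => coin i x) t} /\
           (\int[P]_x bob_time alice bob X Y R (fun i => coin i x)
            <= ((c * (k ^ 3 * n ^ 3))%:R)%:E)%E).
Proof.
exists alice_prog, bob_prog, time_factor; split=> // n k l n0 k0 l0 le_lk.
(* Bob's [m] and [g] take [w] bits each, Alice's hash values [s] bits each. *)
exists (up_log 2 (2 * k * k * n + 4) + up_log 2 (2 * k * k * n + 4) + l * up_log 2 (2 * k * k))%N.
split.
  apply: le_trans (communication_bound R n0 k0 l0) _; rewrite lerD2l ler_nat leq_mul2r.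
  by rewrite /time_factor; apply/orP; right; lia.
move=> X Y Y_uniq sub_XY.
have [sent_le sent_eq answer_eq time_le halts] := protocol_correct n0 k0 l0 le_lk Y_uniq sub_XY.
have run_coin coin t : run alice_prog bob_prog X Y coin t = iter t (joint_step no_coin no_coin)
    (start alice_prog n k l (bits_of X), start bob_prog n k l (bits_of Y)).
  exact: joint_run_coin.
split; last split; last split.
- eexists; split; first exact: leqnn.
  by move=> coin t; rewrite /bits_sent /all_halted run_coin; split; [apply: sent_le | apply: sent_eq].
- by move=> coin t; rewrite run_coin; apply: answer_eq.
- by move=> coin t; rewrite run_coin; case: (time_le t).
move=> d T P coin _; split.
  by apply: aeW => x; case: halts => t ?; exists t; rewrite /all_halted run_coin.
(* Bob's time is the same for every outcome, so its expectation is the integral of a constant over a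
   probability space. *)
have time_coin x : bob_time alice_prog bob_prog X Y R (fun i => coin i x) =
    bob_time alice_prog bob_prog X Y R no_coin.
  by rewrite /bob_time; under eq_fun do rewrite run_coin -(run_coin no_coin).
have time_bob : (bob_time alice_prog bob_prog X Y R no_coin <=
    ((time_factor * (k ^ 3 * n ^ 3))%N%:R)%:E)%E.
  apply/ereal_supP => _ [t _ <-].
  by rewrite lee_fin ler_nat run_coin; case: (time_le t).
under eq_integral do rewrite time_coin.
by rewrite integral_cst//= probability_setT mule1.
Qed.
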